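(* Let $\alpha\in(1,2)$ and $C>0$. Suppose that $\mathbb{P}(W\ge1)=1$ and $\mathbb{P}(W>x)\sim Cx^{-\alpha}$ as $x\to\infty$. For every $\gamma\in(\max(1,3-\frac32\alpha),3)$ and every $a>0$, $$\lim_{n\to\infty}\frac{\log\mathbb{P}(\triangle_n>an^\gamma)}{n^{(\gamma-1)/2}\log n}=\sqrt{2a}\Big(\frac{3-\gamma}{2}-\alpha\Big)<0.$$
   Context: Model: let $W,W_1,W_2,\dots$ be i.i.d. random variables with continuous distribution function $F$ and $\mu=\mathbb{E}[W]$. The random graph has vertex set $\{1,\dots,n\}$; conditionally on the weights, each pair $i\ne j$ is connected by an edge independently with probability $\min(W_iW_j/(\mu n),1)$. $\triangle_n$ is the number of triangles in the graph. $f(x)\sim g(x)$ means $f(x)/g(x)\to1$. *)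

(* Defs.v *)
From HB Require Import structures.
From mathcomp Require Export all_boot all_order all_algebra.
From mathcomp Require Export all_classical all_reals all_analysis.

Set Implicit Arguments.
Unset Strict Implicit.
Unset Printing Implicit Defensive.

Import Order.TTheory GRing.Theory Num.Theory.
Import numFieldNormedType.Exports.

Local Open Scope classical_set_scope.
Local Open Scope ring_scope.

Definition mutually_independent (d : measure_display) (T : measurableType d)
    (R : realType) (P : probability T R) (X : nat -> {RV P >-> R}) : Prop :=
  forall (s : seq nat) (B : nat -> set R),
    uniq s -> (forall i, measurable (B i)) ->
    (P [set t | forall i, i \in s -> X i t \in B i] =
     \prod_(i <- s) P (X i @^-1` B i))%E.

Definition identically_distributed (d : measure_display)
    (T : measurableType d) (R : realType) (P : probability T R)
    (X : nat -> {RV P >-> R}) : Prop :=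
  forall (i j : nat) (B : set R), measurable B ->
    distribution P (X i) B = distribution P (X j) B.

Definition iid (d : measure_display) (T : measurableType d) (R : realType)
    (P : probability T R) (X : nat -> {RV P >-> R}) : Prop :=
  mutually_independent X /\ identically_distributed X.

(* The random variable Y is a version of P(E | G), for G a sub-sigma-algebra
   of the measurable sets of T. *)
Definition is_cond_prob (d : measure_display) (T : measurableType d)
    (R : realType) (P : probability T R) (G : set (set T)) (E : set T)
    (Y : T -> R) : Prop :=
  (forall B : set R, measurable B -> G (Y @^-1` B)) /\
  (forall A : set T, G A -> P (A `&` E) = (\int[P]_(t in A) (Y t)%:E)%E).

(* W 0 is the generic weight, and vertex i : 'I_n has weight W i.+1, so that
   'I_n stands for the vertices 1, ..., n. *)

Definition weight_sigma (d : measure_display) (T : measurableType d)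
    (R : realType) (P : probability T R) (W : nat -> {RV P >-> R})
    (n : nat) : set (set T) :=
  g_sigma_preimage (fun (i : 'I_n) (t : T) => W i.+1 t).

Definition edge_prob (d : measure_display) (T : measurableType d)
    (R : realType) (P : probability T R) (mu : R) (W : nat -> {RV P >-> R})
    (n : nat) (i j : 'I_n) (t : T) : R :=
  Num.min (W i.+1 t * W j.+1 t / (mu * n%:R)) 1.

(* G n t is the adjacency relation of the graph on n vertices at the outcome t.
   Nothing is assumed about the joint law of the graphs for different n.  In
   cond_indep, the one-element sets S give the conditional edge probabilities,
   and the others the conditional independence of the edges. *)
Record weighted_random_graph (d : measure_display) (T : measurableType d)
    (R : realType) (P : probability T R) (mu : R) (W : nat -> {RV P >-> R})
    (G : forall n : nat, T -> rel 'I_n) : Prop := {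
  adj_irr : forall (n : nat) (t : T), irreflexive (G n t) ;
  adj_sym : forall (n : nat) (t : T), symmetric (G n t) ;
  adj_measurable : forall (n : nat) (i j : 'I_n),
    measurable [set t | G n t i j] ;
  cond_indep : forall (n : nat) (S : {set 'I_n * 'I_n}),
    (forall e, e \in S -> (e.1 < e.2)%N) ->
    is_cond_prob P (weight_sigma W n)
      [set t | forall e, e \in S -> G n t e.1 e.2]
      (fun t => \prod_(e in S) edge_prob mu W e.1 e.2 t)
}.

Definition triangles (n : nat) (e : rel 'I_n) : nat :=
  #|[set S : {set 'I_n} | (#|S| == 3) &&
       [forall i in S, forall j in S, (i != j) ==> e i j]]|.

(* Main.v *)
(** With [kappa = (gamma - 1) / 2], the cheapest way to create [a n^gamma]
triangles is to have [k ~ sqrt(2a) n^kappa] hubs of weight of order [n]: a hub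
of weight at least [mu n] is joined to every vertex, so each pair of hubs lies
in about [n] triangles, [k^2 n / 2] in total.  This has probability about
['C(n, k) n^(- alpha k) = exp(- (alpha - (1 - kappa)) k ln n (1 + o(1)))].

For the upper bound, call a vertex heavy if its weight is at least
[n^(1 - 7 eta)].  Triangles with two heavy vertices are at most
[(number of heavy vertices)^2 n / 2], and the number of heavy vertices has a
binomial tail.  It remains to see that more than [eps n^gamma] triangles with
two light vertices [i, j] occur with probability at most
[exp(- n^(kappa + eta / 2))] up to a power of [n], which is negligible.
Conditionally on the weights, the codegree of [i, j] exceeds a multiple of its
mean by [n^(kappa + eta)] with such a small probability, and then the number of
these triangles is a weighted sum of independent edges, with weights [O(n)]
and mean at most [n^(gamma - eta)].  The mean is estimated outside an event of
the same small probability: apart from a set [H] of [n^(kappa + eta)] vertices,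
the weights satisfy [sum w_i^alpha <= n^(1 + 3 eta)], and edge probabilities
are bounded by [w_i w_j / n] or by [(w_i w_j / n)^(alpha / 2)]; the latter
bound, used when no vertex is in [H], is where [3 - 3 alpha / 2 < gamma]
enters. *)

Require Import Defs.
From mathcomp Require Import measurable_realfun ring lra.

Import Order.TTheory GRing.Theory Num.Theory.
Import numFieldNormedType.Exports.

Set Implicit Arguments.
Unset Strict Implicit.
Unset Printing Implicit Defensive.

(** * Counting triangles *)

(** Serves to encode a triangle by a pair [i < j] inside [X] and a third vertex [k], which may lie
    anywhere. *)
Lemma card3_two_in (n : nat) (S X : {set 'I_n}) :
  #|S| = 3 -> 1 < #|S :&: X| ->
  exists i j k : 'I_n, [/\ i < j, i \in X, j \in X, S = k |: [set i; j] & k \notin [set i; j]].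
Proof.
move=> S3 /card_gt1P[i0 [j0 [i0X j0X ij0]]].
have [i [j [ij iX jX]]] : exists i j : 'I_n, [/\ i < j, i \in S :&: X & j \in S :&: X].
  case: (ltngtP i0 j0) => [lt|lt|/val_inj/eqP eq]; first by exists i0, j0.
    by exists j0, i0.
  by rewrite eq in ij0.
move: iX jX; rewrite !inE => /andP[iS iX] /andP[jS jX].
have nij : i != j by rewrite -(inj_eq val_inj) ltn_eqF.
have sub : [set i; j] \subset S by rewrite finset.subUset !finset.sub1set iS jS.
have /eqP/cards1P[k kE] : #|S :\: [set i; j]| = 1.
  by rewrite cardsD (finset.setIidPr sub) S3 cards2 nij.
have : k \in S :\: [set i; j] by rewrite kE inE.
rewrite inE => /andP[kn kS].
exists i, j, k; split => //.
by rewrite -kE finset.setUC -{1}(finset.setIidPr sub) finset.setID.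
Qed.

(** By pigeonhole a triangle has two vertices in [L] or two outside. The latter are counted by a
    pair outside [L] and an arbitrary third vertex, the former by an edge inside [L] and a common
    neighbour; overcounting is harmless. *)
Lemma triangles_le (n : nat) (e : rel 'I_n) (L : {set 'I_n}) :
  triangles e <= 'C(#|~: L|, 2) * n +
    \sum_(p : 'I_n * 'I_n | [&& p.1 < p.2, p.1 \in L & p.2 \in L])
       e p.1 p.2 * #|[set k | e p.1 k && e p.2 k]|.
Proof.
pose Z1 := finset.setX [set D : {set 'I_n} | D \subset ~: L & #|D| == 2] [set: 'I_n].
pose Z2 := [set z : ('I_n * 'I_n) * 'I_n | [&& z.1.1 < z.1.2, z.1.1 \in L,
   z.1.2 \in L, e z.1.1 z.1.2 & e z.1.1 z.2 && e z.1.2 z.2]].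
apply: (@leq_trans (#|Z1| + #|Z2|)); last first.
  rewrite leq_add//.
    by rewrite cardsX cards_draws cardsT card_ord.
  rewrite -sum1_card.
  have -> : \sum_(z in Z2) 1 = \sum_(p : 'I_n * 'I_n | [&& p.1 < p.2, p.1 \in L & p.2 \in L])
      \sum_(k | e p.1 p.2 && (e p.1 k && e p.2 k)) 1.
    by rewrite pair_big_dep; apply: eq_bigl => z; rewrite inE -!andbA.
  apply: leq_sum => p _; case: (e p.1 p.2) => /=; last by rewrite big_pred0.
  by rewrite mul1n -sum1_card leq_eqVlt; apply/orP; left; apply/eqP/eq_bigl => k; rewrite inE.
rewrite /triangles.
apply: (@leq_trans #|[set z.2 |: z.1 | z in Z1] :|:
    [set z.2 |: [set z.1.1; z.1.2] | z in Z2]|); last first.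
  by rewrite (leq_trans (leq_card_setU _ _))// leq_add// leq_imset_card.
apply: subset_leq_card; apply/fintype.subsetP => S; rewrite inE => /andP[/eqP S3 /forall_inP adj].
rewrite inE.
have [|le1] := ltnP 1 #|S :&: L|.
  move=> /(card3_two_in S3)[i [j [k [ij iL jL SE kn]]]].
  apply/orP; right; apply/imsetP; exists ((i, j), k) => //.
  have adjS x y : x \in S -> y \in S -> x != y -> e x y.
    by move=> xS yS xy; have /forall_inP/(_ y yS)/implyP/(_ xy) := adj x xS.
  move: kn; rewrite !inE negb_or => /andP[ki kj].
  have nij : i != j by rewrite -(inj_eq val_inj) ltn_eqF.
  have [iS jS kS] : [/\ i \in S, j \in S & k \in S] by rewrite SE !inE !eqxx !orbT.
  by rewrite /= ij iL jL !adjS// eq_sym.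
have /(card3_two_in S3)[i [j [k [ij iL jL SE kn]]]] : 1 < #|S :&: ~: L|.
  have := cardsID L S; rewrite S3 -finset.setDE => /eqP.
  by case: #|S :&: L| le1 => [|[|//]] _; rewrite ?add0n ?add1n ?eqSS => /eqP ->.
apply/orP; left; apply/imsetP; exists ([set i; j], k) => //.
rewrite !inE andbT finset.subUset !finset.sub1set iL jL /= cards2.
by rewrite eqSS eqb1 -(inj_eq val_inj) neq_ltn ij.
Qed.

(** Counts only triangles with exactly two vertices in [S]: the pair [D] is recovered from [x |: D]
    by intersecting with [S], so none is counted twice. *)
Lemma triangles_ge (n : nat) (e : rel 'I_n) (S : {set 'I_n}) :
  symmetric e ->
  (forall i j, i \in S -> i != j -> e i j) ->
  'C(#|S|, 2) * (n - #|S|) <= triangles e.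
Proof.
move=> syme adj.
pose Z := finset.setX [set D : {set 'I_n} | D \subset S & #|D| == 2] (~: S).
have -> : 'C(#|S|, 2) * (n - #|S|) = #|Z|.
  by rewrite cardsX cards_draws -[in RHS](addKn #|S| #|~: S|) cardsC card_ord.
rewrite -(card_in_imset (f := fun z => z.2 |: z.1)); last first.
  move=> [D x] [D' x']; rewrite !inE /= => /andP[/andP[DS D2] xS] /andP[/andP[DS' D2'] xS'] eqD.
  have DE : D = D'.
    have aux (E : {set 'I_n}) y : E \subset S -> y \notin S -> (y |: E) :&: S = E.
      move=> ES yS; rewrite finset.setIUl (finset.setIidPl ES); apply/finset.setUidPr.
      by apply/fintype.subsetP => z; rewrite !inE => /andP[/eqP->]; rewrite (negbTE yS).
    by rewrite -(aux D x DS xS) eqD aux.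
  congr (_, _) => //.
  have : x \in x' |: D' by rewrite -eqD finset.setU11.
  by rewrite !inE => /orP[/eqP//|/(fintype.subsetP DS')]; rewrite (negbTE xS).
apply: subset_leq_card; apply/fintype.subsetP => Q /imsetP[[D x]].
rewrite !inE /= => /andP[/andP[DS /eqP D2] xS] ->.
have xD : x \notin D by apply/negP => /(fintype.subsetP DS); apply/negP.
rewrite cardsU1 xD D2 /=; apply/forall_inP => i iD; apply/forall_inP => j jD.
apply/implyP => ij.
move: iD jD; rewrite !inE.
move=> /orP[/eqP ix|iD]; last by move=> _; apply: adj => //; exact: (fintype.subsetP DS).
move=> /orP[/eqP jx|jD]; first by rewrite ix jx eqxx in ij.
by rewrite syme; apply: adj; rewrite 1?eq_sym//; exact: (fintype.subsetP DS).
Qed.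

Local Open Scope ring_scope.

(** * Sums over edges and triangles *)

Lemma sum_prod2 (R : comNzRingType) (I : finType) (f g : I -> R) :
  \sum_i \sum_j f i * g j = (\sum_i f i) * (\sum_i g i).
Proof. by rewrite mulr_suml; apply: eq_bigr => i _; rewrite mulr_sumr. Qed.

Lemma sum_prod3 (R : comNzRingType) (I : finType) (f g k : I -> R) :
  \sum_i \sum_j \sum_l f i * g j * k l = (\sum_i f i) * (\sum_i g i) * (\sum_i k i).
Proof.
rewrite -sum_prod2 mulr_suml; apply: eq_bigr => i _; rewrite mulr_suml.
by apply: eq_bigr => j _; rewrite mulr_sumr.
Qed.

Lemma sum_mem_card (R : pzSemiRingType) (I : finType) (H : {set I}) :
  \sum_i (i \in H)%:R = #|H|%:R :> R.
Proof.
rewrite -sum1_card natr_sum [RHS]big_mkcond.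
by apply: eq_bigr => i _; case: (i \in H).
Qed.

Lemma sum_notin (R : pzSemiRingType) (I : finType) (H : {set I}) (f : I -> R) :
  \sum_i (i \notin H)%:R * f i = \sum_(i in ~: H) f i.
Proof.
rewrite [RHS]big_mkcond; apply: eq_bigr => i _.
by rewrite inE; case: (i \in H); rewrite ?mul0r ?mul1r.
Qed.

(* In the next two lemmas [u i ^+ 2] stands for [w_i `^ alpha], [w] for [1 / n],
   [nn] for [n `^ (- alpha / 2)] and [dl] for an upper bound on the weights of
   the light vertices [L], divided by [n]. *)
Lemma sum_edges_le (R : realFieldType) (I : finType) (q : I -> I -> R)
    (H L : {set I}) (u : I -> R) (h S dl w : R) :
  (forall i j, q i j = q j i) -> (forall i j, 0 <= q i j <= 1) ->
  (forall i, 0 <= u i) -> 0 <= w -> 0 <= dl ->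
  (forall i j, q i j <= u i ^+ 2 * u j ^+ 2 * w) ->
  (forall i j, i \in L -> q i j <= dl * u j ^+ 2) ->
  #|H|%:R <= h -> \sum_(i in ~: H) u i ^+ 2 <= S ->
  \sum_(i in L) \sum_(j in L) q i j <= h * h + S * S * w + 2 * dl * h * S.
Proof.
move=> qC q01 u0 w0 dl0 qz qdl Hh HS.
pose a i : R := (i \in H)%:R; pose z i : R := (i \notin H)%:R * u i ^+ 2.
have a0 i : 0 <= a i by exact: ler0n.
have z0 i : 0 <= z i by rewrite mulr_ge0// exprn_ge0.
have aE : \sum_i a i = #|H|%:R by exact: sum_mem_card.
have zE : \sum_i z i = \sum_(i in ~: H) u i ^+ 2 by exact: sum_notin.
have A0 : 0 <= \sum_i a i by exact: sumr_ge0.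
have Z0 : 0 <= \sum_i z i by exact: sumr_ge0.
rewrite -aE in Hh; rewrite -zE in HS.
(* One term per position relative to [H]: both vertices in [H], where [q] is at most 1; neither;
   exactly one, where the vertex in [H] is light and [qdl] applies. *)
pose F i j := a i * a j + z i * (w * z j) + (dl * a i) * z j + z i * (dl * a j).
have F0 i j : 0 <= F i j by rewrite /F !addr_ge0 ?mulr_ge0.
apply: (@le_trans _ _ (\sum_i \sum_j F i j)).
  rewrite big_mkcond; apply: ler_sum => i _; case: ifP => iL; last exact: sumr_ge0.
  rewrite big_mkcond; apply: ler_sum => j _; case: ifP => jL; last exact: F0.
  rewrite /F /a /z.
  have /andP[_ q1] := q01 i j.
  have := qz i j; have := qdl i j iL; have := qdl j i jL; rewrite (qC j i).
  case: (i \in H); case: (j \in H); rewrite /=; lra.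
under eq_bigr do rewrite /F !big_split /=.
rewrite !big_split /= !sum_prod2 -!mulr_sumr.
set A := \sum_i a i in A0 Hh *; set Z := \sum_i z i in Z0 HS *.
have h1 : A * A <= h * h by exact: ler_pM.
have h2 : Z * Z <= S * S by exact: ler_pM.
have h3 : A * Z <= h * S by exact: ler_pM.
have h2' := ler_wpM2r w0 h2; have h3' := ler_wpM2l dl0 h3.
lra.
Qed.

Lemma sum_triangles_le (R : realFieldType) (I : finType) (q : I -> I -> R)
    (H L : {set I}) (u : I -> R) (h S dl w nn : R) :
  (forall i j, q i j = q j i) -> (forall i j, 0 <= q i j <= 1) ->
  (forall i, 0 <= u i) -> 0 <= w -> 0 <= dl -> 0 <= nn ->
  (forall i j, q i j <= u i ^+ 2 * u j ^+ 2 * w) ->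
  (forall i j, q i j <= u i * u j * nn) ->
  (forall i j, i \in L -> q i j <= dl * u j ^+ 2) ->
  #|H|%:R <= h -> \sum_(i in ~: H) u i ^+ 2 <= S ->
  \sum_(i in L) \sum_(j in L) q i j * \sum_k q i k * q j k <=
    h * h * h + 3 * (h * S * S * w) + 3 * (dl * (h * h * S)) + S * S * S * nn ^+ 3.
Proof.
move=> qC q01 u0 w0 dl0 nn0 qz qn qdl Hh HS.
pose a i : R := (i \in H)%:R; pose z i : R := (i \notin H)%:R * u i ^+ 2.
have a0 i : 0 <= a i by exact: ler0n.
have z0 i : 0 <= z i by rewrite mulr_ge0// exprn_ge0.
have aE : \sum_i a i = #|H|%:R by exact: sum_mem_card.
have zE : \sum_i z i = \sum_(i in ~: H) u i ^+ 2 by exact: sum_notin.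
have A0 : 0 <= \sum_i a i by exact: sumr_ge0.
have Z0 : 0 <= \sum_i z i by exact: sumr_ge0.
rewrite -aE in Hh; rewrite -zE in HS.
(* Sorted by the number of vertices in [H]. Three: the bound 1. One: [qz] on the opposite edge. Two:
   one of them is in [L], and [qdl] bounds its edge to the third vertex. None: [qn] on all three
   edges. *)
pose F i j k := a i * a j * a k
  + ((w * a i) * z j * z k + (w * z i) * a j * z k + (w * z i) * z j * a k)
  + ((dl * a i) * a j * z k + (dl * a i) * z j * a k + (dl * z i) * a j * a k)
  + (nn ^+ 3 * z i) * z j * z k.
have F0 i j k : 0 <= F i j k by rewrite /F !addr_ge0 ?mulr_ge0 ?exprn_ge0.
apply: (@le_trans _ _ (\sum_i \sum_j \sum_k F i j k)).
  rewrite big_mkcond; apply: ler_sum => i _; case: ifP => iL; last by do 2 apply: sumr_ge0 => ? _.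
  rewrite big_mkcond; apply: ler_sum => j _; case: ifP => jL; last by apply: sumr_ge0 => ? _.
  rewrite mulr_sumr; apply: ler_sum => k _.
  rewrite mulrA.
  have q0 x y : 0 <= q x y by case/andP: (q01 x y).
  have q1 x y : q x y <= 1 by case/andP: (q01 x y).
  have t_ij : q i j * q i k * q j k <= q i j.
    by rewrite -[leRHS]mulr1 -mulrA ler_wpM2l// mulr_ile1.
  have t_ik : q i j * q i k * q j k <= q i k.
    by rewrite mulrAC mulrC -[leRHS]mulr1 ler_wpM2l// mulr_ile1.
  have t_jk : q i j * q i k * q j k <= q j k.
    by rewrite mulrC -[leRHS]mulr1 ler_wpM2l// mulr_ile1.
  have t_n : q i j * q i k * q j k <= nn ^+ 3 * u i ^+ 2 * u j ^+ 2 * u k ^+ 2.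
    rewrite [leRHS](_ : _ = (u i * u j * nn) * (u i * u k * nn) * (u j * u k * nn)); last by ring.
    by rewrite !ler_pM ?mulr_ge0.
  rewrite /F /a /z.
  have := qz i j; have := qz i k; have := qz j k.
  have := qdl i j iL; have := qdl i k iL; have := qdl j i jL; rewrite (qC j i).
  have := q1 i j.
  case: (i \in H); case: (j \in H); case: (k \in H); rewrite /=; lra.
under eq_bigr do under eq_bigr do rewrite /F !big_split /=.
under eq_bigr do rewrite !big_split /=.
rewrite !big_split /= !sum_prod3 -!mulr_sumr.
set A := \sum_i a i in A0 Hh *; set Z := \sum_i z i in Z0 HS *.
have h1 : A * A * A <= h * h * h by rewrite !ler_pM ?mulr_ge0.
have h2 : Z * Z * Z <= S * S * S by rewrite !ler_pM ?mulr_ge0.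
have h3 : A * A * Z <= h * h * S by rewrite !ler_pM ?mulr_ge0.
have h4 : A * Z * Z <= h * S * S by rewrite !ler_pM ?mulr_ge0.
have h2' := ler_wpM2r (exprn_ge0 3 nn0) h2.
have h3' := ler_wpM2l dl0 h3; have h4' := ler_wpM2r w0 h4.
lra.
Qed.

Local Open Scope classical_set_scope.
Local Open Scope ring_scope.

(** * Exponential tail bounds *)

(** The event is a finite union, over the truth assignments accepted by [F], of finite
    intersections. This settles measurability for events about the graph and about counts of large
    weights. *)
Lemma measurable_finbool (d : measure_display) (T : measurableType d)
    (I : finType) (b : I -> T -> bool) (F : {ffun I -> bool} -> bool) :
  (forall i, measurable [set t | b i t]) ->
  measurable [set t | F [ffun i => b i t]].
Proof.
move=> mb.
have -> : [set t | F [ffun i => b i t]] =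
    \big[setU/set0]_(f in [pred f | F f]) \bigcap_i [set t | b i t = f i].
  rewrite -bigcup_pred; apply/seteqP; split=> t /=.
    by move=> Ft; exists [ffun i => b i t] => // i _ /=; rewrite ffunE.
  move=> [f /= Ff] bf.
  by rewrite (_ : [ffun i => b i t] = f) //; apply/ffunP => i; rewrite ffunE bf.
apply: bigsetU_measurable => f _; apply: fin_bigcap_measurable => // i _.
case: (f i).
  rewrite (_ : [set _ | _] = [set t | b i t]) //.
rewrite (_ : [set _ | _] = ~` [set t | b i t]); first exact: measurableC.
by apply/seteqP; split=> t /=; case: (b i t).
Qed.

Lemma measurable_all_bool (d : measure_display) (T : measurableType d)
    (I : finType) (b : I -> T -> bool) (S : {set I}) :
  (forall i, measurable [set t | b i t]) ->
  measurable [set t | forall i, i \in S -> b i t].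
Proof.
move=> mb.
rewrite (_ : [set t | _] = [set t | [forall i, (i \in S) ==> [ffun j => b j t] i]]).
  exact: (@measurable_finbool _ _ _ b (fun f => [forall i, (i \in S) ==> f i])).
apply/seteqP; split=> t /=.
  by move=> H; apply/forallP => i; apply/implyP => iS; rewrite ffunE H.
by move=> /forallP H i iS; have := H i; rewrite iS /= ffunE.
Qed.

(* Only upper bounds on the probabilities of joint occurrence are needed: the
   exponential moment expands into a positive combination of these, by
   [expR (c * b) = 1 + (expR c - 1) * b] for a boolean [b]. *)
Lemma chernoff (d : measure_display) (T : measurableType d) (R : realType)
    (P : probability T R) (I : finType) (b : I -> T -> bool) (A : set T)
    (q c : I -> R) (r : R) :
  measurable A -> (forall i, measurable [set t | b i t]) ->
  (forall i, 0 <= q i) -> (forall i, 0 <= c i) ->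
  (forall S : {set I}, P (A `&` [set t | forall i, i \in S -> b i t]) <=
      P A * (\prod_(i in S) q i)%:E)%E ->
  (P (A `&` [set t | r < \sum_i c i * (b i t)%:R]%R) <=
      P A * (expR (- r + \sum_i q i * (expR (c i) - 1)))%:E)%E.
Proof.
move=> mA mb q0 c0 HS.
set E := A `&` _.
pose B (S : {set I}) := A `&` [set t | forall i, i \in S -> b i t].
pose w (S : {set I}) := \prod_(i in S) (expR (c i) - 1).
have mB S : measurable (B S) by apply: measurableI => //; exact: measurable_all_bool.
have mE : measurable E.
  apply: measurableI => //.
  rewrite (_ : [set t | _] = [set t | r < \sum_i c i * ([ffun i => b i t] i)%:R]%R).
    exact: (@measurable_finbool _ _ _ b (fun f => r < \sum_i c i * (f i)%:R)).
  by apply: eq_set => t; congr (is_true (_ < _)); apply: eq_bigr => i _; rewrite ffunE.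
have ec0 i : 0 <= expR (c i) - 1 by rewrite subr_ge0 -expR0 ler_expR.
have w0 S : 0 <= w S by apply: prodr_ge0 => i _.
(* The expanded exponential moment, restricted to [A]: it is at least [expR r] on [E], and its
   integral involves only the joint probabilities. *)
pose f t := \sum_(S : {set I}) ((w S)%:E * (\1_(B S) t)%:E)%E.
have mf : forall S, measurable_fun setT ((fun t => (w S)%:E * (\1_(B S) t)%:E)%E : T -> \bar R).
  move=> S; apply: emeasurable_funM; first exact: measurable_cst.
  by apply/measurable_EFinP; exact: measurable_indic.
have If : (\int[P]_t f t = \sum_(S : {set I}) (w S)%:E * P (B S))%E.
  rewrite /f ge0_integral_sum//; last first.
    by move=> S x _; rewrite mule_ge0// lee_fin.
  apply: eq_bigr => S _; rewrite ge0_integralZl_EFin//; last first.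
    by apply/measurable_EFinP; exact: measurable_indic.
  by rewrite integral_indic// setIT.
have le1 : (\int[P]_t ((expR r)%:E * (\1_E t)%:E) <= \int[P]_t f t)%E.
  apply: ge0_le_integral => //.
  - by apply/emeasurable_funM/measurable_EFinP => //; exact: measurable_indic.
  - by apply: emeasurable_sum.
  - move=> t _; rewrite /f.
    have [tE|tE] := pselect (E t); last first.
      rewrite indicE memNset// mule0; apply: sume_ge0 => S _.
      by rewrite mule_ge0// lee_fin.
    rewrite indicE mem_set// mule1.
    under eq_bigr => S _ do rewrite -EFinM.
    rewrite sumEFin lee_fin.
    apply: (@le_trans _ _ (expR (\sum_i c i * (b i t)%:R))).
      by rewrite ler_expR ltW//; case: tE.
    rewrite expR_sum.
    under eq_bigr => i _.
      rewrite (_ : expR _ = (expR (c i) - 1) * (b i t)%:R + 1); last first.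
        by case: (b i t); rewrite ?mulr1 ?mulr0 ?subrK// expR0 add0r.
      over.
    (* After expansion over subsets, the term of [S] is [w S] times the indicator that all [b i]
       with [i] in [S] hold. *)
    rewrite bigA_distr; apply: ler_sum => S _.
    rewrite -big_mkcond /= big_split /= -/(w S) ler_wpM2l//.
    have [tS|tS] := boolP [forall i, (i \in S) ==> b i t].
      rewrite indicE mem_set; last first.
        split; first by case: tE.
        by move=> i iS; move/forallP : tS => /(_ i); rewrite iS.
      by apply: prodr_ile1 => i _; case: (b i t); rewrite ?lexx ler01.
    move: tS; rewrite negb_forall => /existsP[i]; rewrite negb_imply => /andP[iS bi].
    by rewrite (bigD1 i)//= (negbTE bi) mul0r.
have Hs : (\sum_(S : {set I}) (w S)%:E * P (B S) <=
    P A * (expR (\sum_i q i * (expR (c i) - 1)))%:E)%E.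
  apply: (@le_trans _ _ (\sum_(S : {set I}) P A * (w S * \prod_(i in S) q i)%:E)%E).
    apply: lee_sum => S _; rewrite EFinM muleCA lee_wpmul2l ?lee_fin//; exact: HS.
  rewrite -ge0_sume_distrr; last first.
    by move=> S _; rewrite lee_fin mulr_ge0// prodr_ge0.
  rewrite lee_wpmul2l// sumEFin lee_fin.
  (* The subset sum is refolded into a product, whose factors are bounded by 1 + x <= exp x. *)
  apply: (@le_trans _ _ (\prod_i (q i * (expR (c i) - 1) + 1))).
    rewrite bigA_distr; apply: ler_sum => S _.
    by rewrite -big_mkcond /= big_split /= mulrC.
  rewrite expR_sum; apply: ler_prod => i _.
  by rewrite addr_ge0 ?mulr_ge0//= addrC expR_ge1Dx.
have : ((expR r)%:E * P E <= P A * (expR (\sum_i q i * (expR (c i) - 1)))%:E)%E.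
  apply: le_trans Hs; rewrite -If; apply: le_trans le1.
  rewrite ge0_integralZl_EFin ?expR_ge0//; last first.
    by apply/measurable_EFinP; exact: measurable_indic.
  by rewrite integral_indic// setIT.
move=> H; rewrite expRD EFinM muleCA.
have -> : P E = ((expR (- r))%:E * ((expR r)%:E * P E))%E.
  by rewrite muleA -EFinM -expRD addNr expR0 mul1e.
by rewrite lee_wpmul2l// lee_fin expR_ge0.
Qed.

(** * Weights and edges *)

Lemma weight_sigma_measurable (d : measure_display) (T : measurableType d)
    (R : realType) (P : probability T R) (W : nat -> {RV P >-> R}) (n : nat) :
  weight_sigma W n `<=` measurable.
Proof.
apply: smallest_sub; first exact: sigma_algebra_measurable.
rewrite -bigcup_pred => A [i _ [B mB <-]].
exact: measurable_funP.
Qed.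

Lemma weight_sigma_forall (d : measure_display) (T : measurableType d)
    (R : realType) (P : probability T R) (W : nat -> {RV P >-> R}) (n : nat)
    (B : 'I_n -> set R) :
  (forall i, measurable (B i)) ->
  weight_sigma W n [set t | forall i : 'I_n, B i (W i.+1 t)].
Proof.
move=> mB.
(* The sigma-algebra of the weights becomes a measurable structure of its own, so that finite
   intersections stay inside it. *)
pose U := g_sigma_algebraType (\big[setU/set0]_(i < n)
   preimage_set_system [set: T] (W i.+1) (@measurable _ R)).
have : measurable (\bigcap_(i in [set: 'I_n]) ((W i.+1 @^-1` B i) : set U)).
  apply: fin_bigcap_measurable => // i _.
  apply: sub_sigma_algebra; rewrite -bigcup_pred.
  by exists i => //; exists (B i) => //; rewrite setTI.
congr (weight_sigma W n _).
by apply/seteqP; split=> t /= H i *; exact: H.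
Qed.

Lemma measurable_weights (d : measure_display) (T : measurableType d)
    (R : realType) (P : probability T R) (W : nat -> {RV P >-> R}) (i : nat)
    (B : set R) :
  measurable B -> measurable [set t | B (W i t)].
Proof. by move=> mB; rewrite -[X in measurable X]setTI; exact: measurable_funP. Qed.

Lemma iid_forall (d : measure_display) (T : measurableType d)
    (R : realType) (P : probability T R) (W : nat -> {RV P >-> R}) (n : nat)
    (S : {set 'I_n}) (B : 'I_n -> set R) :
  iid W -> (forall i, measurable (B i)) ->
  (P [set t | forall i, i \in S -> B i (W i.+1 t)] =
   \prod_(i in S) P [set t | B i (W 0%N t)])%E.
Proof.
move=> [ind idd] mB.
(* Transports [B] to the indices of [W], shifted by one since vertex [i] carries [W i.+1]; indices
   beyond the vertices get the whole line. *)
pose B' (j : nat) := if insub j.-1 is Some i then B i else setT.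
have mB' j : measurable (B' j) by rewrite /B'; case: insub.
have B'E (i : 'I_n) : B' i.+1 = B i by rewrite /B' /= valK.
have us : uniq [seq (i : nat).+1 | i : 'I_n <- enum S].
  rewrite map_inj_uniq ?enum_uniq// => i j [] /val_inj //.
have := ind _ _ us mB'.
rewrite big_map big_enum /= => H.
rewrite (_ : [set t | _] =
  [set t | forall i, i \in [seq (i : nat).+1 | i : 'I_n <- enum S] -> W i t \in B' i]).
  rewrite H; apply: eq_bigr => i iS; rewrite B'E.
  exact: (idd i.+1 0%N (B i) (mB i)).
apply/seteqP; split=> t /= H1 i.
  by move/mapP=> [j]; rewrite mem_enum => jS ->; rewrite B'E inE; exact: H1.
move=> iS; have := H1 i.+1; rewrite B'E inE; apply.
by rewrite map_f// mem_enum.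
Qed.

(** [A] is determined by the weights, so the conditional probability of the edges can be integrated
    over [A], where it is at most a constant product. *)
Lemma edges_le (d : measure_display) (T : measurableType d)
    (R : realType) (P : probability T R) (mu : R) (W : nat -> {RV P >-> R})
    (G : forall n : nat, T -> rel 'I_n) (n : nat) (A : set T)
    (q : 'I_n * 'I_n -> R) (S : {set 'I_n * 'I_n}) :
  weighted_random_graph mu W G -> weight_sigma W n A ->
  (forall e, e \in S -> (e.1 < e.2)%N) ->
  (forall t e, A t -> e \in S -> 0 <= edge_prob mu W e.1 e.2 t <= q e) ->
  (P (A `&` [set t | forall e, e \in S -> G n t e.1 e.2]) <=
   P A * (\prod_(e in S) q e)%:E)%E.
Proof.
move=> GW sA ltS qS; have mA := weight_sigma_measurable sA.
have [mY ->//] := cond_indep GW ltS.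
rewrite muleC -integral_cst//; apply: ge0_le_integral => //.
- by move=> t At; rewrite lee_fin prodr_ge0// => e eS; have /andP[] := qS t e At eS.
- apply/measurable_EFinP; apply: (measurable_funTS) => //.
  by move=> _ B mB; rewrite setTI; apply: weight_sigma_measurable; exact: mY.
- by move=> t At; rewrite lee_fin; apply: ler_prod => e eS; exact: qS.
Qed.

Lemma edges_sure (d : measure_display) (T : measurableType d)
    (R : realType) (P : probability T R) (mu : R) (W : nat -> {RV P >-> R})
    (G : forall n : nat, T -> rel 'I_n) (n : nat) (A : set T)
    (S : {set 'I_n * 'I_n}) :
  weighted_random_graph mu W G -> weight_sigma W n A ->
  (forall e, e \in S -> (e.1 < e.2)%N) ->
  (forall t e, A t -> e \in S -> edge_prob mu W e.1 e.2 t = 1) ->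
  P (A `&` [set t | forall e, e \in S -> G n t e.1 e.2]) = P A.
Proof.
move=> GW sA ltS qS; have mA := weight_sigma_measurable sA.
have [mY ->//] := cond_indep GW ltS.
rewrite (eq_integral (cst 1%E)); last first.
  move=> t; rewrite inE => At /=; congr EFin.
  by rewrite big1// => e eS; exact: qS.
by rewrite integral_cst// mul1e.
Qed.

(** * Triangles given the weights *)

(** From exp(- x) >= 1 - x follows exp x - 1 <= x exp x, and exp x <= e on the unit interval. *)
Lemma expR_sub1_le (R : realType) (x : R) : 0 <= x <= 1 -> expR x - 1 <= expR 1 * x.
Proof.
move=> /andP[x0 x1]; apply: (@le_trans _ _ (expR x * x)); last first.
  by rewrite ler_wpM2r// ler_expR.
have := expR_ge1Dx (- x).
rewrite -(ler_pM2l (expR_gt0 x)) -expRD subrr expR0; lra.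
Qed.

Lemma measure_bigsetU_le (d : measure_display) (T : measurableType d) (R : realType)
    (P : probability T R) (I : finType) (Q : pred I) (B : I -> set T) :
  (forall i, Q i -> measurable (B i)) ->
  (P (\big[setU/set0]_(i | Q i) B i) <= \sum_(i | Q i) P (B i))%E.
Proof.
move=> mB.
suff [] : measurable (\big[setU/set0]_(i | Q i) B i) /\
   (P (\big[setU/set0]_(i | Q i) B i) <= \sum_(i | Q i) P (B i))%E by [].
apply: (big_rec2 (fun (X : set T) (y : \bar R) => measurable X /\ (P X <= y)%E)).
  by rewrite measure0.
move=> i x y Qi [mx xy]; split; first by apply: measurableU => //; exact: mB.
by apply: le_trans (leeD2l _ xy); apply: measureU2 => //; exact: mB.
Qed.

(** The model describes edges only through pairs in increasing order; this is the representative of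
    the edge between [i] and [k]. *)
Definition ordered_pair (n : nat) (i k : 'I_n) : 'I_n * 'I_n :=
  if (i < k)%N then (i, k) else (k, i).

Lemma ordered_pair_lt (n : nat) (i k : 'I_n) :
  i != k -> ((ordered_pair i k).1 < (ordered_pair i k).2)%N.
Proof.
by rewrite /ordered_pair -(inj_eq val_inj); case: (ltngtP i k).
Qed.

Lemma ordered_pair_inj (n : nat) (i : 'I_n) : injective (ordered_pair i).
Proof.
by move=> k k'; rewrite /ordered_pair; case: ifP => _; case: ifP => _ [] *; congruence.
Qed.

(** The edges from [i] and from [j] to the vertices of [S] are all distinct, so [edges_le] yields
    the product. If [S] contains [i] or [j], the event is empty, as there are no loops. *)
Lemma codegree_joint (d : measure_display) (T : measurableType d)
    (R : realType) (P : probability T R) (mu : R) (W : nat -> {RV P >-> R})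
    (G : forall n : nat, T -> rel 'I_n) (n : nat) (A : set T)
    (q : 'I_n -> 'I_n -> R) (i j : 'I_n) (S : {set 'I_n}) :
  weighted_random_graph mu W G -> weight_sigma W n A ->
  (forall i j, q i j = q j i) -> (forall i j, 0 <= q i j) ->
  (forall t i j, A t -> 0 <= edge_prob mu W i j t <= q i j) ->
  i != j ->
  (P (A `&` [set t | forall k, k \in S -> G n t i k && G n t j k]) <=
   P A * (\prod_(k in S) (q i k * q j k))%:E)%E.
Proof.
move=> GW sA qC q0 qW ij; have mA := weight_sigma_measurable sA.
have mG x y : measurable [set t | G n t x y] by exact: adj_measurable GW _ _ _.
have irr t x : G n t x x = false by rewrite (adj_irr GW).
have sym t x y : G n t x y = G n t y x by rewrite (adj_sym GW).
have [|ijS] := boolP ((i \in S) || (j \in S)).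
  move=> ijS; rewrite (_ : _ `&` _ = set0).
    by rewrite measure0 mule_ge0// lee_fin prodr_ge0// => k _; rewrite mulr_ge0.
  apply/seteqP; split => // t [_ /= H].
  by case/orP: ijS => /H; rewrite irr ?andbF.
move: ijS; rewrite negb_or => /andP[iS jS].
pose E := ([set ordered_pair i k | k in S] :|: [set ordered_pair j k | k in S])%SET.
have nk x k : x \notin S -> k \in S -> x != k.
  by move=> xS kS; apply: contraNneq xS => ->.
have ltE e : e \in E -> (e.1 < e.2)%N.
  by rewrite !inE => /orP[] /imsetP[k kS ->]; apply: ordered_pair_lt; exact: nk.
have dis : fintype.disjoint (mem [set ordered_pair i k | k in S]%SET)
    (mem [set ordered_pair j k | k in S]%SET).
  apply/pred0P => e /=; apply/negP => /andP[/imsetP[k kS ->] /imsetP[l lS]].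
  have := nk i l iS lS; have := nk j k jS kS; move: ij.
  rewrite /ordered_pair => /eqP n1 /eqP n2 /eqP n3.
  by case: ifP => _; case: ifP => _ [] *; congruence.
have GE t x k : G n t (ordered_pair x k).1 (ordered_pair x k).2 = G n t x k.
  by rewrite /ordered_pair; case: ifP => //= _; rewrite sym.
have qE x k : q (ordered_pair x k).1 (ordered_pair x k).2 = q x k.
  by rewrite /ordered_pair; case: ifP => //= _; rewrite qC.
have EE : [set t | forall e, e \in E -> G n t e.1 e.2] =
    [set t | forall k, k \in S -> G n t i k && G n t j k].
  apply/seteqP; split => t /= H.
    move=> k kS; rewrite -(GE t i) -(GE t j).
    by rewrite !H// inE; apply/orP; [right|left]; apply/imsetP; exists k.
  by move=> e; rewrite !inE => /orP[] /imsetP[k /H/andP[Gi Gj] ->]; rewrite GE.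
have EP : \prod_(e in E) q e.1 e.2 = \prod_(k in S) (q i k * q j k).
  rewrite (eq_bigl [predU [set ordered_pair i k | k in S]%SET
    & [set ordered_pair j k | k in S]%SET]); last by move=> e; rewrite !inE.
  rewrite bigU//= !big_imset /=; first last.
  - by move=> x y _ _; exact: ordered_pair_inj.
  - by move=> x y _ _; exact: ordered_pair_inj.
  by rewrite -big_split /=; apply: eq_bigr => k _; rewrite !qE.
rewrite [X in A `&` X](esym EE) -EP.
apply: (edges_le (q := fun e => q e.1 e.2) GW sA ltE).
by move=> t e At _; exact: qW.
Qed.

(** The Chernoff bound with all coefficients 1: e times the mean in the threshold absorbs e - 1
    times the mean, leaving [- h]. *)
Lemma codegree_tail (d : measure_display) (T : measurableType d)
    (R : realType) (P : probability T R) (mu : R) (W : nat -> {RV P >-> R})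
    (G : forall n : nat, T -> rel 'I_n) (n : nat) (A : set T)
    (q : 'I_n -> 'I_n -> R) (i j : 'I_n) (h : R) :
  weighted_random_graph mu W G -> weight_sigma W n A ->
  (forall i j, q i j = q j i) -> (forall i j, 0 <= q i j) ->
  (forall t i j, A t -> 0 <= edge_prob mu W i j t <= q i j) ->
  i != j ->
  (P (A `&` [set t | expR 1 * (\sum_k q i k * q j k) + h <
       #|[set k | G n t i k && G n t j k]%SET|%:R]%R) <= P A * (expR (- h))%:E)%E.
Proof.
move=> GW sA qC q0 qW ij; have mA := weight_sigma_measurable sA.
have mG x y : measurable [set t | G n t x y] by exact: adj_measurable GW _ _ _.
have mb k : measurable [set t | G n t i k && G n t j k].
  rewrite (_ : [set t | _] = [set t | G n t i k] `&` [set t | G n t j k]).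
    exact: measurableI.
  by apply/seteqP; split => t /=; [case/andP|move/andP].
have := @chernoff _ _ _ P _ (fun k t => G n t i k && G n t j k) A
   (fun k => q i k * q j k) (fun=> 1) (expR 1 * (\sum_k q i k * q j k) + h)
   mA mb (fun k => mulr_ge0 (q0 _ _) (q0 _ _)) (fun=> ler01)
   (fun S => codegree_joint S GW sA qC q0 qW ij).
rewrite (_ : [set t | _] = [set t | expR 1 * (\sum_k q i k * q j k) + h <
       #|[set k | G n t i k && G n t j k]%SET|%:R]%R); last first.
  apply: eq_set => t; congr (is_true (_ < _)).
  rewrite -sum1_card natr_sum [RHS]big_mkcond; apply: eq_bigr => k _.
  by rewrite inE mul1r; case: (_ && _).
move/le_trans; apply; rewrite lee_wpmul2l// lee_fin ler_expR -mulr_suml.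
have : 0 <= \sum_k q i k * q j k by apply: sumr_ge0 => k _; rewrite mulr_ge0.
lra.
Qed.

(* First bound all codegrees, then the sum over the edges inside [L] of these
   bounds; [tau] is an upper bound on the codegree bounds. *)
Lemma light_triangles_tail (d : measure_display) (T : measurableType d)
    (R : realType) (P : probability T R) (mu : R) (W : nat -> {RV P >-> R})
    (G : forall n : nat, T -> rel 'I_n) (n : nat) (A : set T)
    (q : 'I_n -> 'I_n -> R) (L : {set 'I_n}) (h r tau : R) :
  weighted_random_graph mu W G -> weight_sigma W n A ->
  (forall i j, q i j = q j i) -> (forall i j, 0 <= q i j) ->
  (forall t i j, A t -> 0 <= edge_prob mu W i j t <= q i j) ->
  0 <= h -> 0 < tau ->
  (forall i j, expR 1 * (\sum_k q i k * q j k) + h <= tau) ->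
  (P (A `&` [set t | r < (\sum_(p : 'I_n * 'I_n | [&& p.1 < p.2, p.1 \in L & p.2 \in L])
       G n t p.1 p.2 * #|[set k | G n t p.1 k && G n t p.2 k]%SET|)%N%:R]%R) <=
   P A * (n%:R ^+ 2 * expR (- h) +
      expR (- (r / tau) + expR 1 / tau *
        \sum_(i in L) \sum_(j in L) q i j * (expR 1 * (\sum_k q i k * q j k) + h)))%:E)%E.
Proof.
move=> GW sA qC q0 qW h0 tau0 ctau; have mA := weight_sigma_measurable sA.
have mG x y : measurable [set t | G n t x y] by exact: adj_measurable GW _ _ _.
pose Q (p : 'I_n * 'I_n) := [&& (p.1 < p.2)%N, p.1 \in L & p.2 \in L].
pose c (p : 'I_n * 'I_n) := expR 1 * (\sum_k q p.1 k * q p.2 k) + h.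
pose cod t (p : 'I_n * 'I_n) := #|[set k | G n t p.1 k && G n t p.2 k]%SET|.
have c0 p : 0 <= c p.
  by rewrite addr_ge0// mulr_ge0 ?expR_ge0// sumr_ge0// => k _; rewrite mulr_ge0.
(* Pairs outside [Q] get no edge and probability 0, so that the Chernoff bound can run over all
   pairs. *)
pose b p t := Q p && G n t p.1 p.2.
pose q' p := if Q p then q p.1 p.2 else 0.
have mb p : measurable [set t | b p t].
  rewrite /b; case: (Q p) => /=; first exact: mG.
  by rewrite (_ : [set _ | _] = set0) //; apply/seteqP; split.
have Hb (S : {set 'I_n * 'I_n}) : (P (A `&` [set t | forall p, p \in S -> b p t]) <=
    P A * (\prod_(p in S) q' p)%:E)%E.
  have [/forall_inP SQ|/forall_inPn[p pS nQ]] := boolP [forall p in S, Q p].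
    rewrite (_ : \prod_(p in S) q' p = \prod_(p in S) q p.1 p.2); last first.
      by apply: eq_bigr => p pS; rewrite /q' SQ.
    rewrite [X in A `&` X](_ : _ = [set t | forall p, p \in S -> G n t p.1 p.2]); last first.
      apply/seteqP; split => t /= H p pS; first by have /andP[] := H p pS.
      by rewrite /b SQ// H.
    apply: (@edges_le _ _ _ _ mu W G n A (fun e => q e.1 e.2) S GW sA).
      by move=> e /SQ /and3P[].
    by move=> t e At _; exact: qW.
  rewrite (_ : _ `&` _ = set0).
    rewrite measure0 mule_ge0// lee_fin prodr_ge0// => k _.
    by rewrite /q'; case: ifP.
  by apply/seteqP; split => // t [_ /= /(_ p pS)]; rewrite /b (negbTE nQ).
(* Division by [tau] brings the coefficients into the unit interval, where exp x - 1 has a linear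
   bound. *)
have H2 := @chernoff _ _ _ P _ b A q' (fun p => c p / tau) (r / tau) mA mb _ _ Hb.
pose E1 p := A `&` [set t | c p < (cod t p)%:R].
pose E2 := A `&` [set t | r / tau < \sum_p c p / tau * (b p t)%:R].
have mE1 p : measurable (E1 p).
  apply: measurableI => //.
  have := @measurable_finbool _ _ _ (fun x t => G n t x.1 x.2)
    (fun f => c p < #|[set k | f (p.1, k) && f (p.2, k)]%SET|%:R) (fun x => mG x.1 x.2).
  congr measurable; apply: eq_set => t; congr (is_true (_ < _%:R)).
  by apply: eq_card => k; rewrite !inE !ffunE.
have mE2 : measurable E2.
  apply: measurableI => //.
  have := @measurable_finbool _ _ _ b
    (fun f => r / tau < \sum_p c p / tau * (f p)%:R) mb.
  congr measurable; apply: eq_set => t; congr (is_true (_ < _)).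
  by apply: eq_bigr => p _; rewrite !ffunE.
(* Either the codegree of some pair in [L] exceeds its bound [c p], or the codegrees may be replaced
   by these bounds in the sum. *)
apply: (@le_trans _ _ (P ((\big[setU/set0]_(p | Q p) E1 p) `|` E2))).
  apply: le_measure; rewrite ?inE.
  - apply: measurableI => //.
    have := @measurable_finbool _ _ _ (fun x t => G n t x.1 x.2)
      (fun f => r < (\sum_(p | Q p) f p * #|[set k | f (p.1, k) && f (p.2, k)]%SET|)%N%:R)
      (fun x => mG x.1 x.2).
    congr measurable; apply: eq_set => t; congr (is_true (_ < _%:R)).
    apply: eq_bigr => p _; rewrite ffunE; congr (_ * _)%N.
    by apply: eq_card => k; rewrite !inE !ffunE.
  - by apply: measurableU => //; apply: bigsetU_measurable.
  move=> t [At /= rt].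
  have [[p [Qp pt]]|nE] := pselect (exists p, Q p /\ c p < (cod t p)%:R).
    by left; rewrite -bigcup_pred; exists p.
  right; split => //=; rewrite ltr_pdivrMr// mulr_suml.
  apply: lt_le_trans rt _; rewrite natr_sum big_mkcond; apply: ler_sum => p _.
  rewrite mulrAC divfK ?gt_eqF// /b -/(Q p); case: ifP => [Qp|_]; last by rewrite mulr_ge0.
  rewrite natrM mulrC ler_wpM2r// leNgt; apply/negP => lt; apply: nE; by exists p.
apply: (le_trans (measureU2 _ _ _)) => //; first by apply: bigsetU_measurable.
have PA : P A \is a fin_num by exact: fin_num_measure.
rewrite EFinD muleDr//; apply: leeD.
  apply: (le_trans (measure_bigsetU_le _ _)) => //.
  apply: (@le_trans _ _ (\sum_(p | Q p) P A * (expR (- h))%:E)%E).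
    apply: lee_sum => p /and3P[lt _ _]; apply: (codegree_tail _ GW sA) => //.
    by rewrite -(inj_eq val_inj) ltn_eqF.
  rewrite -ge0_sume_distrr; last by move=> p _; rewrite lee_fin expR_ge0.
  rewrite lee_wpmul2l// sumEFin lee_fin sumr_const -[leLHS]mulr_natl.
  rewrite ler_wpM2r ?expR_ge0// -natrX ler_nat.
  by rewrite (leq_trans (max_card _))// card_prod card_ord.
apply: le_trans (H2 _ _) _.
- by move=> p; rewrite /q'; case: ifP.
- by move=> p; rewrite divr_ge0// ltW.
rewrite lee_wpmul2l// lee_fin ler_expR lerD2l.
rewrite mulr_sumr [leRHS]big_mkcond/=.
rewrite -(pair_bigA _ (fun i j => q' (i, j) * (expR (c (i, j) / tau) - 1)))/=.
apply: ler_sum => i _; case: ifP => iL; last first.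
  by rewrite big1// => j _; rewrite /q' /Q /= iL andbF mul0r.
rewrite mulr_sumr [leRHS]big_mkcond/=; apply: ler_sum => j _; case: ifP => jL; last first.
  by rewrite /q' /Q /= jL !andbF mul0r.
apply: (@le_trans _ _ (q i j * (expR (c (i, j) / tau) - 1))).
  have e0 : 0 <= expR (c (i, j) / tau) - 1.
    by rewrite subr_ge0 -expR0 ler_expR divr_ge0// ltW.
  by rewrite /q'; case: ifP => _; rewrite ?lexx// mul0r mulr_ge0.
rewrite mulrCA ler_wpM2l//.
apply: le_trans (expR_sub1_le _) _.
  apply/andP; split; first by rewrite divr_ge0// ltW.
  by rewrite ler_pdivrMr// mul1r ctau.
by rewrite /c /= mulrA mulrAC.
Qed.

(** * Weight classes *)

Lemma measure_disjoint_bigsetU (d : measure_display) (T : measurableType d) (R : realType)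
    (P : probability T R) (I : finType) (Q : pred I) (B : I -> set T) :
  (forall i, measurable (B i)) ->
  (forall i j t, B i t -> B j t -> i = j) ->
  P (\big[setU/set0]_(i | Q i) B i) = (\sum_(i | Q i) P (B i))%E.
Proof.
move=> mB dB; have := index_enum_uniq I; elim: (index_enum I) => [_|i s IH].
  by rewrite !big_nil measure0.
rewrite cons_uniq => /andP[ns us]; rewrite !big_cons; case: (Q i); last exact: IH.
rewrite -(IH us); apply: measureU => //; first exact: bigsetU_measurable.
apply/seteqP; split => // t [Bi]; rewrite -bigcup_seq_cond => -[j /= /andP[js _] Bj].
by move: ns; rewrite (dB _ _ _ Bi Bj) js.
Qed.

Lemma probability_setIr (d : measure_display) (T : measurableType d) (R : realType)
    (P : probability T R) (E O : set T) :
  measurable E -> measurable O -> P O = 1%E -> P (E `&` O) = P E.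
Proof.
move=> mE mO PO.
have P0 : P (~` O) = 0%E by rewrite probability_setC// PO subee.
rewrite [RHS](@measureDI _ _ _ P _ O)// [X in (X + _)%E](_ : _ = 0%E) ?add0e//.
apply/eqP; rewrite -measure_le0 -P0; apply: le_measure; rewrite ?inE//.
- exact: measurableD.
- exact: measurableC.
Qed.

Lemma measurable_ge (R : realType) (y : R) : measurable [set w : R | y <= w].
Proof.
have -> : [set w : R | y <= w] = [set` `[y, +oo[] by rewrite set_itvcy.
exact: measurable_itv.
Qed.

Lemma weights_ge1 (d : measure_display) (T : measurableType d)
    (R : realType) (P : probability T R) (W : nat -> {RV P >-> R}) (n : nat) :
  iid W -> P [set t | 1 <= W 0%N t] = 1%E ->
  P [set t | forall i : 'I_n, 1 <= W i.+1 t] = 1%E.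
Proof.
move=> iidW W1.
have := @iid_forall _ _ _ P W n [set: 'I_n]%SET (fun=> [set w | 1 <= w]) iidW.
rewrite (_ : [set t | _] = [set t | forall i : 'I_n, 1 <= W i.+1 t]).
  move=> ->; first by apply: big1 => i _; exact: W1.
  by move=> _; exact: measurable_ge.
by apply/seteqP; split => t /= H i; [apply: H; rewrite inE|move=> _; exact: H].
Qed.

Lemma measurable_weight_ge (d : measure_display) (T : measurableType d)
    (R : realType) (P : probability T R) (W : nat -> {RV P >-> R}) (i : nat) (y : R) :
  measurable [set t | y <= W i t].
Proof.
apply: (measurable_weights W i (B := [set w | y <= w])).
exact: measurable_ge.
Qed.

(** A Chernoff bound whose joint probabilities come from independence of the weights. The parameter
    [c] stays free: class sizes use 1, the number of heavy vertices needs order [ln n]. *)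
Lemma weight_count_tail (d : measure_display) (T : measurableType d)
    (R : realType) (P : probability T R) (W : nat -> {RV P >-> R}) (n : nat)
    (y p m c : R) :
  iid W -> (P [set t | y <= W 0%N t]%R <= p%:E)%E -> 0 < c ->
  (P [set t | m < #|[set i : 'I_n | y <= W i.+1 t]%SET|%:R]%R <=
    (expR (- (c * m) + n%:R * p * (expR c - 1)))%:E)%E.
Proof.
move=> iidW Py c0.
have p0 : 0 <= p by rewrite -lee_fin (le_trans _ Py).
have my := measurable_ge y.
have := @chernoff _ _ _ P 'I_n (fun i t => y <= W i.+1 t) setT (fun=> p) (fun=> c) (c * m)
  measurableT (fun i => measurable_weight_ge W i.+1 y) (fun=> p0) (fun=> ltW c0).
rewrite probability_setT mul1e setTI.
rewrite (_ : [set t | _] = [set t | m < #|[set i : 'I_n | y <= W i.+1 t]%SET|%:R]); last first.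
  apply: eq_set => t; rewrite -mulr_sumr ltr_pM2l//; congr (is_true (_ < _)).
  rewrite -sum1_card natr_sum [RHS]big_mkcond; apply: eq_bigr => k _.
  by rewrite inE; case: (_ <= _).
move/(_ _)/le_trans; apply.
  move=> S; rewrite setTI mul1e (@iid_forall _ _ _ P W n S (fun=> [set w | y <= w]))//.
  apply: proj2; apply: (big_rec2 (fun (a : \bar R) (b : R) => 0 <= a /\ a <= b%:E)%E).
    by rewrite lexx lee01.
  move=> i a b _ [b0 ab]; rewrite mule_ge0// EFinM; split => //; exact: lee_pmul.
by rewrite lee_fin ler_expR lerD2l sumr_const card_ord -[leLHS]mulr_natl mulrA.
Qed.

(* On the event that all weights lie in prescribed classes, the edge
   probabilities are bounded by constants; this replaces conditioning on the
   weights by a finite partition. *)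
Definition weight_class (R : realType) (y : nat -> R) (K l : nat) : set R :=
  [set w | y l <= w /\ ((l < K)%N -> w < y l.+1)].

Lemma weight_class_exists (R : realType) (y : nat -> R) (K : nat) (w : R) :
  y 0%N <= w -> exists l : 'I_K.+1, weight_class y K l w.
Proof.
move=> y0.
have [l yl maxl] := arg_maxnP (fun l : 'I_K.+1 => l : nat) (i0 := ord0)
  (P := fun l : 'I_K.+1 => y l <= w) y0.
exists l; split => // lK; rewrite ltNge; apply/negP => yl1.
have lt : (l.+1 < K.+1)%N by [].
by have := maxl (Ordinal lt) yl1; rewrite /= ltnn.
Qed.

Lemma weight_class_inj (R : realType) (y : nat -> R) (K : nat) (w : R) (l l' : 'I_K.+1) :
  {homo y : i j / (i <= j)%N >-> i <= j} ->
  weight_class y K l w -> weight_class y K l' w -> l = l'.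
Proof.
move=> homy.
wlog le : l l' / (l <= l')%N.
  by move=> H; case/orP: (leq_total l l') => [/H//|/H{}H] c1 c2; apply/esym/H.
move=> [yl yl1] [yl' _]; apply/val_inj/eqP => /=; rewrite eqn_leq le /=.
rewrite leqNgt; apply/negP => lt.
have lK : (l < K)%N by rewrite (leq_trans lt)// -ltnS.
by have := lt_le_trans (yl1 lK) (le_trans (homy _ _ lt) yl'); rewrite ltxx.
Qed.

Lemma measurable_weight_class (R : realType) (y : nat -> R) (K l : nat) :
  measurable (weight_class y K l).
Proof.
have [lK|lK] := boolP (l < K)%N; last first.
  rewrite (_ : weight_class y K l = [set w | y l <= w]); first exact: measurable_ge.
  by apply/seteqP; split => w; [case|move=> ?; split => // H; rewrite H in lK].
rewrite (_ : weight_class y K l = [set w | y l <= w] `\` [set w | y l.+1 <= w]).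
  by apply: measurableD; exact: measurable_ge.
apply/seteqP; split => w [yl].
  by move=> /(_ lK) ylw; split => //=; apply/negP; rewrite -ltNge.
by move=> /negP /=; rewrite -ltNge; split.
Qed.

Definition weight_cell (d : measure_display) (T : measurableType d)
    (R : realType) (P : probability T R) (W : nat -> {RV P >-> R}) (y : nat -> R)
    (K n : nat) (v : {ffun 'I_n -> 'I_K.+1}) : set T :=
  [set t | forall i : 'I_n, weight_class y K (v i) (W i.+1 t)].

Lemma weight_cell_sigma (d : measure_display) (T : measurableType d)
    (R : realType) (P : probability T R) (W : nat -> {RV P >-> R}) (y : nat -> R)
    (K n : nat) (v : {ffun 'I_n -> 'I_K.+1}) : weight_sigma W n (weight_cell W y v).
Proof. exact: (weight_sigma_forall (fun i => measurable_weight_class y K (v i))). Qed.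

(** Either some class is overfull, so that too many weights reach [y l], or the weights lie in a
    cell obeying the bounds [M]. Such cells are disjoint, so their total probability is at most 1
    and [beta] is paid only once. *)
Lemma weight_cell_union_le (d : measure_display) (T : measurableType d)
    (R : realType) (P : probability T R) (W : nat -> {RV P >-> R}) (y : nat -> R)
    (K n : nat) (M : nat -> R) (E : set T) (beta : R) :
  iid W -> P [set t | 1 <= W 0%N t] = 1%E ->
  y 0%N = 1 -> {homo y : i j / (i <= j)%N >-> i <= j} -> measurable E -> 0 <= beta ->
  (forall v : {ffun 'I_n -> 'I_K.+1},
     (forall l : 'I_K.+1, #|[set i | v i == l]%SET|%:R <= M l) ->
     (P (weight_cell W y v `&` E) <= P (weight_cell W y v) * beta%:E)%E) ->
  (P E <= \sum_(l < K.+1) P [set t | (M l < #|[set i : 'I_n | y l <= W i.+1 t]%SET|%:R)%R]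
          + beta%:E)%E.
Proof.
move=> iidW W1 y0 homy mE b0 Hv.
pose good (v : {ffun 'I_n -> 'I_K.+1}) := [forall l : 'I_K.+1, #|[set i | v i == l]%SET|%:R <= M l].
pose Bad (l : 'I_K.+1) := [set t | M l < #|[set i : 'I_n | y l <= W i.+1 t]%SET|%:R].
have mcell (v : {ffun 'I_n -> 'I_K.+1}) : measurable (weight_cell W y v).
  exact: (weight_sigma_measurable (weight_cell_sigma y v)).
have mBad l : measurable (Bad l).
  have := @measurable_finbool _ _ _ (fun (i : 'I_n) t => y l <= W i.+1 t)
    (fun f => M l < #|[set i | f i]%SET|%:R) (fun i => measurable_weight_ge W i.+1 (y l)).
  congr measurable; apply: eq_set => t; congr (is_true (_ < _%:R)).
  by apply: eq_card => i; rewrite !inE ffunE.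
have dcell (v v' : {ffun 'I_n -> 'I_K.+1}) t :
    weight_cell W y v t -> weight_cell W y v' t -> v = v'.
  by move=> cv cv'; apply/ffunP => i; exact: weight_class_inj (cv i) (cv' i).
have mO : measurable [set t | forall i : 'I_n, 1 <= W i.+1 t].
  have := @measurable_finbool _ _ _ (fun (i : 'I_n) t => 1 <= W i.+1 t)
    (fun f => [forall i, f i]) (fun i => measurable_weight_ge W i.+1 1).
  congr measurable; apply/seteqP; split => t /=.
    by move=> /forallP H i; have := H i; rewrite ffunE.
  by move=> H; apply/forallP => i; rewrite ffunE.
(* Discards a null event, since the classes cover only weights from [y 0 = 1] on. *)
rewrite -(probability_setIr mE mO (weights_ge1 n iidW W1)).
apply: (@le_trans _ _ (P ((\big[setU/set0]_(l | true) Bad l) `|`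
   (\big[setU/set0]_(v | good v) (weight_cell W y v `&` E))))).
  apply: le_measure; rewrite ?inE.
  - exact: measurableI.
  - by apply: measurableU; apply: bigsetU_measurable => // v _; exact: measurableI.
  move=> t [Et Ot].
  have Hc (i : 'I_n) : {l : 'I_K.+1 | weight_class y K l (W i.+1 t)}.
    by apply/cid/weight_class_exists; rewrite y0; exact: Ot.
  pose v := [ffun i => sval (Hc i)].
  have cv : weight_cell W y v t.
    by move=> i; rewrite /v ffunE; case: (Hc i).
  have [gv|] := boolP (good v).
    by right; rewrite -bigcup_pred; exists v.
  rewrite negb_forall => /existsP[l]; rewrite -ltNge => Ml.
  left; rewrite -bigcup_pred; exists l => //=.
  apply: lt_le_trans Ml _; rewrite ler_nat; apply: subset_leq_card.
  apply/fintype.subsetP => i; rewrite !inE => /eqP <-; by have [] := cv i.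
apply: (le_trans (measureU2 _ _ _)) => //.
  by apply: bigsetU_measurable.
  by apply: bigsetU_measurable => v _; exact: measurableI.
apply: leeD.
  exact: measure_bigsetU_le.
apply: le_trans (measure_bigsetU_le _ _) _.
  by move=> v _; exact: measurableI.
apply: (@le_trans _ _ (\sum_(v | good v) beta%:E * P (weight_cell W y v))%E).
  by apply: lee_sum => v /forallP gv; rewrite muleC; exact: Hv.
rewrite -ge0_sume_distrr// -measure_disjoint_bigsetU//.
rewrite -[leRHS]mule1 lee_wpmul2l ?lee_fin//; apply: probability_le1.
exact: bigsetU_measurable.
Qed.

Lemma card_sum_fibers (R : numDomainType) (I J : finType) (v : I -> J) (Q : pred J) :
  #|[set i | Q (v i)]%SET|%:R = \sum_(l | Q l) #|[set i | v i == l]%SET|%:R :> R.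
Proof.
rewrite -natr_sum -sum1_card; congr (_%:R).
rewrite (partition_big v Q) /=; last by move=> i; rewrite inE.
apply: eq_bigr => l Ql; rewrite -sum1_card; apply: eq_bigl => i.
by rewrite !inE; case: eqP => [->|]; rewrite ?Ql ?andbT ?andbF.
Qed.

Lemma sum_fibers (R : realDomainType) (I J : finType) (v : I -> J) (Q : pred J) (f : J -> R) :
  \sum_(i | Q (v i)) f (v i) = \sum_(l | Q l) f l * #|[set i | v i == l]%SET|%:R.
Proof.
rewrite (partition_big v Q) //=.
apply: eq_bigr => l Ql; rewrite -sum1_card natr_sum mulr_sumr; apply: eq_big => i.
  by rewrite inE; case: eqP => [->|]; rewrite ?Ql ?andbT ?andbF.
by move=> /andP[_ /eqP ->]; rewrite mulr1.
Qed.

(** On a cell the edge probabilities have a deterministic bound [q], so [light_triangles_tail]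
    applies with the cell as [A]; the class sizes [M] control the sums of [q]. The set [H] collects
    the vertices whose class satisfies [Hp]. *)
Lemma cell_light_triangles_tail (d : measure_display) (T : measurableType d)
    (R : realType) (P : probability T R) (mu : R) (W : nat -> {RV P >-> R})
    (G : forall n : nat, T -> rel 'I_n) (n K hh : nat) (y M : nat -> R)
    (v : {ffun 'I_n -> 'I_K.+1}) (L : {set 'I_n}) (Hp : pred nat)
    (alpha dl h S r : R) :
  weighted_random_graph mu W G -> (0 < n)%N -> 1 <= mu ->
  1 < alpha -> alpha < 2 ->
  y 0%N = 1 -> {homo y : i j / (i <= j)%N >-> i <= j} -> n%:R <= y K ->
  (forall l : 'I_K.+1, #|[set i | v i == l]%SET|%:R <= M l) ->
  \sum_(l < K.+1 | Hp l) M l <= h ->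
  \sum_(l < K.+1 | ~~ Hp l) y l.+1 `^ alpha * M l <= S ->
  0 <= dl -> y hh <= dl * n%:R -> 0 <= h -> h <= n%:R ->
  (forall i, i \in L -> (v i < hh)%N) ->
  (P (weight_cell W y v `&`
    [set t | r < (\sum_(p : 'I_n * 'I_n | [&& p.1 < p.2, p.1 \in L & p.2 \in L])
       G n t p.1 p.2 * #|[set k | G n t p.1 k && G n t p.2 k]%SET|)%N%:R]%R) <=
   P (weight_cell W y v) * (n%:R ^+ 2 * expR (- h) +
      expR (- (r / ((expR 1 + 1) * n%:R)) + 3 * expR 1 / n%:R *
        (h * h * h + h * S * S * n%:R^-1 + dl * (h * h * S)
         + S * S * S * (n%:R `^ (- (alpha / 2))) ^+ 3)))%:E)%E.
Proof.
move=> GW n0 mu1 al1 al2 y0 homy yK Hv Hh HS dl0 ydl h0 hn HL.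
have N0 : 0 < n%:R :> R by rewrite ltr0n.
have y1 l : 1 <= y l by rewrite -y0; apply: homy.
(* Weights are rounded up to the end of their class. In the top class [x i] need not bound the
   weight, but there [x i >= n] already forces [q] to be 1. *)
pose x i := y (v i).+1.
have x1 i : 1 <= x i by exact: y1.
have x0 i : 0 <= x i by exact: le_trans ler01 (x1 i).
pose u i := x i `^ (alpha / 2).
have u0 i : 0 <= u i by exact: powR_ge0.
have u2 i : u i ^+ 2 = x i `^ alpha.
  by rewrite -powR_mulrn// -powRrM divfK.
have xu i : x i <= u i ^+ 2.
  rewrite u2 -[leLHS]powRr1 ?(le_trans ler01)//; apply: ler_powR => //; exact: ltW.
pose q i j := Num.min (x i * x j / n%:R) 1.
have qC i j : q i j = q j i by rewrite /q (mulrC (x i)).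
have qx i j : q i j <= x i * x j / n%:R by rewrite /q ge_min lexx.
have xx0 i j : 0 <= x i * x j / n%:R by rewrite divr_ge0 ?mulr_ge0// ltW.
have q01 i j : 0 <= q i j <= 1.
  by rewrite /q le_min xx0 ler01 ge_min lexx orbT.
have q0 i j : 0 <= q i j by case/andP : (q01 i j).
have n1 : 1 <= n%:R :> R by rewrite ler1n.
have qz i j : q i j <= u i ^+ 2 * u j ^+ 2 * n%:R^-1.
  by apply: le_trans (qx i j) _; rewrite ler_wpM2r ?invr_ge0 ?ler0n// ler_pM.
(* Since [alpha / 2] lies between 0 and 1, min(s, 1) is at most s^(alpha / 2). *)
have qn i j : q i j <= u i * u j * n%:R `^ (- (alpha / 2)).
  have -> : u i * u j * n%:R `^ (- (alpha / 2)) = (x i * x j / n%:R) `^ (alpha / 2).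
    by rewrite powRM ?mulr_ge0 ?invr_ge0// powRM// -(@powR_inv1 _ n%:R)// -powRrM mulN1r.
  have t0 : 0 < x i * x j / n%:R by rewrite divr_gt0// mulr_gt0// (lt_le_trans ltr01).
  have [le1|gt1] := leP (x i * x j / n%:R) 1.
    apply: le_trans (qx i j) _; apply: ger1_powR; last by rewrite ler_pdivrMr//; lra.
    by rewrite t0.
  have al0 : 0 <= alpha / 2 by rewrite divr_ge0//; lra.
  by have := ler_powR (ltW gt1) al0; rewrite powRr0 /q (min_idPr (ltW gt1)).
have qdl i j : i \in L -> q i j <= dl * u j ^+ 2.
  move=> /HL iL; apply: le_trans (qx i j) _.
  rewrite mulrAC; apply: ler_pM => //; first by rewrite divr_ge0// ltW.
  by rewrite ler_pdivrMr//; apply: le_trans ydl; exact: homy.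
have qW t i j : weight_cell W y v t -> 0 <= edge_prob mu W i j t <= q i j.
  move=> cv; rewrite /edge_prob.
  have [Wi Wi'] := cv i; have [Wj Wj'] := cv j.
  have Wi1 : 1 <= W i.+1 t by exact: le_trans Wi.
  have Wj1 : 1 <= W j.+1 t by exact: le_trans Wj.
  have muN : 0 < mu * n%:R by rewrite mulr_gt0// (lt_le_trans ltr01).
  apply/andP; split.
    by rewrite le_min ler01 andbT divr_ge0 ?mulr_ge0// ?ltW//; exact: lt_le_trans ltr01 _.
  have [vK|vK] := boolP ((v i < K)%N && (v j < K)%N).
    have /andP[vi vj] := vK.
    rewrite /q le_min ge_min [X in X || _](_ : _ = true) ?ge_min ?lexx ?orbT//.
    apply: ler_pM; rewrite ?mulr_ge0 ?invr_ge0 ?(ltW muN)//; rewrite ?(le_trans ler01)//.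
      apply: ler_pM; rewrite ?(le_trans ler01)//; first exact/ltW/Wi'.
      exact/ltW/Wj'.
    by rewrite lef_pV2// ler_peMl// ltW.
  rewrite /q [X in _ <= X](_ : _ = 1) ?ge_min ?lexx ?orbT//.
  apply/min_idPr; rewrite ler_pdivlMr// mul1r.
  have xK k : ~~ (v k < K)%N -> n%:R <= x k.
    by rewrite -leqNgt => Kv; apply: le_trans yK _; apply: homy; rewrite leqW.
  move: vK; rewrite negb_and => /orP[] /xK nx.
    by rewrite -[leLHS]mulr1; apply: ler_pM.
  by rewrite -[leLHS]mul1r; apply: ler_pM.
pose H := [set i | Hp (v i)]%SET.
have cH : #|H|%:R <= h.
  rewrite /H (@card_sum_fibers _ _ _ v (fun l => Hp l)); apply: le_trans Hh.
  exact: ler_sum.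
have sH : \sum_(i in ~: H) u i ^+ 2 <= S.
  under eq_bigr do rewrite u2.
  rewrite (eq_bigl (fun i => ~~ Hp (v i))); last by move=> i; rewrite !inE.
  rewrite (@sum_fibers _ _ _ v (fun l => ~~ Hp l) (fun l => y l.+1 `^ alpha)).
  apply: le_trans HS; apply: ler_sum => l _; rewrite ler_wpM2l ?powR_ge0//.
have tau0 : 0 < (expR 1 + 1) * n%:R :> R by rewrite mulr_gt0// addr_gt0 ?expR_gt0.
(* The mean codegree is at most [n] because [q] is at most 1, and [h <= n]. *)
have qtau i j : expR 1 * (\sum_k q i k * q j k) + h <= (expR 1 + 1) * n%:R.
  rewrite mulrDl mul1r lerD// ler_wpM2l ?expR_ge0//.
  rewrite -[n in leRHS]card_ord -sum1_card natr_sum; apply: ler_sum => k _.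
  by apply: mulr_ile1 => //; [case/andP: (q01 i k)|case/andP: (q01 j k)].
have sC := weight_cell_sigma (W := W) y v.
apply: le_trans (light_triangles_tail L r GW sC qC q0 qW h0 tau0 qtau) _.
rewrite lee_wpmul2l// lee_fin lerD2l ler_expR lerD2l.
have w0 : 0 <= n%:R^-1 :> R by rewrite invr_ge0 ler0n.
have E1 := sum_edges_le qC q01 u0 w0 dl0 qz qdl cH sH.
have E2 := sum_triangles_le qC q01 u0 w0 dl0 (powR_ge0 _ _) qz qn qdl cH sH.
have -> : \sum_(i in L) \sum_(j in L) q i j * (expR 1 * (\sum_k q i k * q j k) + h) =
    expR 1 * (\sum_(i in L) \sum_(j in L) q i j * \sum_k q i k * q j k)
    + h * \sum_(i in L) \sum_(j in L) q i j.
  rewrite !mulr_sumr -big_split; apply: eq_bigr => i _ /=.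
  rewrite !mulr_sumr -big_split; apply: eq_bigr => j _ /=; ring.
have S0 : 0 <= S by apply: le_trans sH; apply: sumr_ge0 => i _; rewrite exprn_ge0.
set X4 := S * S * S * _ ^+ 3 in E2 *.
have X40 : 0 <= X4 by rewrite /X4 !mulr_ge0 ?exprn_ge0 ?powR_ge0.
have X10 : 0 <= h * h * h by rewrite !mulr_ge0.
have X20 : 0 <= h * S * S * n%:R^-1 by rewrite !mulr_ge0.
have X30 : 0 <= dl * (h * h * S) by rewrite !mulr_ge0.
have e0 : 0 <= expR 1 :> R by exact: expR_ge0.
set e := expR 1 in e0 *.
have E1' := ler_wpM2l h0 E1; have E2' := ler_wpM2l e0 E2.
(* Isolates the common prefactor; the remaining inequality is linear in the four terms. *)
have -> : 3 * e / n%:R * (h * h * h + h * S * S / n%:R + dl * (h * h * S) + X4) =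
   e / ((e + 1) * n%:R) * (3 * (e + 1) * (h * h * h + h * S * S / n%:R + dl * (h * h * S) + X4)).
  field; rewrite gt_eqF//= gt_eqF//; lra.
apply: ler_wpM2l; first by rewrite divr_ge0// ltW.
set X2 := h * S * S / n%:R in X20 E2' *; set X3 := dl * (h * h * S) in X30 E2' *.
set X1 := h * h * h in X10 E2' *.
have E3 : h * (h * h + S * S / n%:R + 2 * dl * h * S) = X1 + X2 + 2 * X3.
  by rewrite /X1 /X2 /X3; ring.
rewrite E3 in E1'.
have := mulr_ge0 e0 X10; have := mulr_ge0 e0 X20; have := mulr_ge0 e0 X30; have := mulr_ge0 e0 X40.
lra.
Qed.

(** * A tail bound for fixed n *)

Lemma measurable_triangles (d : measure_display) (T : measurableType d)
    (R : realType) (P : probability T R) (mu : R) (W : nat -> {RV P >-> R})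
    (G : forall n : nat, T -> rel 'I_n) (n : nat) (F : nat -> bool) :
  weighted_random_graph mu W G -> measurable [set t | F (triangles (G n t))].
Proof.
move=> GW.
have mG x y : measurable [set t | G n t x y] by exact: adj_measurable GW _ _ _.
have := @measurable_finbool _ _ _ (fun x t => G n t x.1 x.2)
  (fun f => F (triangles (fun i j => f (i, j)))) (fun x => mG x.1 x.2).
congr measurable; apply: eq_set => t; congr (is_true (F (triangles _))).
by apply/funext => i; apply/funext => j; rewrite ffunE.
Qed.

(* [m] bounds the number of vertices of weight at least [y hh], which create at
   most [m ^+ 2 / 2 * n] triangles with two such vertices. *)
Lemma triangles_tail_le (d : measure_display) (T : measurableType d)
    (R : realType) (P : probability T R) (mu : R) (W : nat -> {RV P >-> R})
    (G : forall n : nat, T -> rel 'I_n) (n K hh : nat) (y M p : nat -> R)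
    (Hp : pred nat) (alpha dl h S r m c : R) :
  weighted_random_graph mu W G -> iid W -> P [set t | 1 <= W 0%N t] = 1%E ->
  (0 < n)%N -> 1 <= mu ->
  1 < alpha -> alpha < 2 ->
  y 0%N = 1 -> {homo y : i j / (i <= j)%N >-> i <= j} -> n%:R <= y K ->
  (forall l, P [set t | y l <= W 0%N t]%R <= (p l)%:E)%E ->
  \sum_(l < K.+1 | Hp l) M l <= h ->
  \sum_(l < K.+1 | ~~ Hp l) y l.+1 `^ alpha * M l <= S ->
  0 <= dl -> y hh <= dl * n%:R -> (hh <= K)%N -> 0 <= h -> h <= n%:R -> 0 <= m -> 0 < c ->
  (P [set t | (m ^+ 2 / 2 * n%:R + r < (triangles (G n t))%:R)%R] <=
   (expR (- (c * m) + n%:R * p hh * (expR c - 1))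
    + \sum_(l < K.+1) expR (- M l + n%:R * p l * (expR 1 - 1))
    + (n%:R ^+ 2 * expR (- h) +
      expR (- (r / ((expR 1 + 1) * n%:R)) + 3 * expR 1 / n%:R *
        (h * h * h + h * S * S * n%:R^-1 + dl * (h * h * S)
         + S * S * S * (n%:R `^ (- (alpha / 2))) ^+ 3))))%:E)%E.
Proof.
move=> GW iidW W1 n0 mu1 al1 al2 y0 homy yK Pp Hh HS dl0 ydl hhK h0 hn m0 c0.
set beta := n%:R ^+ 2 * _ + _.
have beta0 : 0 <= beta by rewrite addr_ge0 ?mulr_ge0 ?exprn_ge0 ?expR_ge0.
set E := [set t | _].
pose D := [set t | m < #|[set i : 'I_n | y hh <= W i.+1 t]%SET|%:R].
have mE : measurable E.
  exact: (@measurable_triangles _ _ _ P mu W G n (fun k => m ^+ 2 / 2 * n%:R + r < k%:R) GW).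
have mD : measurable D.
  have := @measurable_finbool _ _ _ (fun (i : 'I_n) t => y hh <= W i.+1 t)
    (fun f => m < #|[set i | f i]%SET|%:R) (fun i => measurable_weight_ge W i.+1 (y hh)).
  congr measurable; apply: eq_set => t; congr (is_true (_ < _%:R)).
  by apply: eq_card => i; rewrite !inE ffunE.
have mED : measurable (E `\` D) by exact: measurableD.
have PD : (P D <= (expR (- (c * m) + n%:R * p hh * (expR c - 1)))%:E)%E.
  exact: weight_count_tail.
have PED : (P (E `\` D) <=
    \sum_(l < K.+1) P [set t | (M l < #|[set i : 'I_n | y l <= W i.+1 t]%SET|%:R)%R]
    + beta%:E)%E.
  apply: weight_cell_union_le => // v Hv.
  (* Outside [D], at most [m] vertices are missing from [L]. *)
  pose L := [set i | (v i < hh)%N]%SET.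
  have HL i : i \in L -> (v i < hh)%N by rewrite inE.
  apply: le_trans
    (cell_light_triangles_tail r GW n0 mu1 al1 al2 y0 homy yK Hv Hh HS dl0 ydl h0 hn HL).
  apply: le_measure; rewrite ?inE.
  - apply: measurableI => //; exact: (weight_sigma_measurable (weight_cell_sigma y v)).
  - apply: measurableI; first exact: (weight_sigma_measurable (weight_cell_sigma y v)).
    have mG i j : measurable [set t | G n t i j] by exact: adj_measurable GW _ _ _.
    have := @measurable_finbool _ _ _ (fun x t => G n t x.1 x.2)
      (fun f => r < (\sum_(q : 'I_n * 'I_n | [&& (q.1 < q.2)%N, q.1 \in L & q.2 \in L])
        f q * #|[set k | f (q.1, k) && f (q.2, k)]%SET|)%N%:R)
      (fun x => mG x.1 x.2).
    congr measurable; apply: eq_set => t; congr (is_true (_ < _%:R)).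
    apply: eq_bigr => q _; rewrite ffunE; congr (_ * _)%N.
    by apply: eq_card => k; rewrite !inE !ffunE.
  move=> t [cv [Et nD]]; split => //=.
  have := triangles_le (G n t) L; rewrite -(ler_nat R) natrD natrM => tri.
  have cL : #|~: L|%:R <= m.
    rewrite leNgt; apply/negP => lt; apply: nD; apply: lt_le_trans lt _.
    rewrite ler_nat; apply: subset_leq_card; apply/fintype.subsetP => i.
    rewrite !inE -leqNgt => hv; have [yv _] := cv i.
    exact: le_trans (homy _ _ hv) yv.
  have bin : 'C(#|~: L|, 2)%:R <= m ^+ 2 / 2 :> R.
    rewrite ler_pdivlMr// -natrM -[2%N]/(2`!) bin_ffact ffactnSr ffactn1.
    apply: (@le_trans _ _ (#|~: L|%:R ^+ 2)).
      by rewrite expr2 -natrM ler_nat leq_mul// leq_subr.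
    by rewrite lerXn2r ?nnegrE.
  have := ler_wpM2r (ler0n R n) bin; move: Et tri; rewrite /E /=; lra.
have -> : E = E `&` D `|` E `\` D by rewrite setUIDK.
apply: (le_trans (measureU2 _ _ _)) => //; first exact: measurableI.
rewrite -addrA EFinD; apply: leeD.
  by apply: le_trans PD; apply: le_measure; rewrite ?inE//; exact: measurableI.
apply: (le_trans PED); rewrite [leRHS]EFinD; apply: leeD => //.
rewrite -sumEFin; apply: lee_sum => l _.
have := @weight_count_tail _ _ _ P W n (y l) (p l) (M l) 1 iidW (Pp l) ltr01.
by rewrite mul1r.
Qed.

(** * Asymptotic upper bound *)

Lemma powR_add (R : realType) (N x y : R) : 0 < N -> N `^ (x + y) = N `^ x * N `^ y.
Proof. by move=> N0; rewrite powRD// (gt_eqF N0) implybT. Qed.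

Lemma near_powR_dominates (R : realType) (A x y : R) :
  x < y -> \forall n \near \oo, A * n%:R `^ x <= n%:R `^ y.
Proof.
move=> xy; near=> n.
have d0 : 0 < y - x by rewrite subr_gt0.
have n1 : 1 <= n%:R :> R by near: n; exact: nbhs_infty_ger.
have n0 : 0 < n%:R :> R by exact: lt_le_trans n1.
rewrite -(subrK x y) powR_add// ler_wpM2r ?powR_ge0//.
have An : (`|A|) `^ (y - x)^-1 <= n%:R by near: n; exact: nbhs_infty_ger.
apply: le_trans (ler_norm A) _.
have -> : `|A| = (`|A| `^ (y - x)^-1) `^ (y - x).
  by rewrite -powRrM mulVf ?powRr1// lt0r_neq0.
by apply: (ge0_ler_powR (ltW d0)); rewrite ?nnegrE ?powR_ge0//.
Unshelve. all: by end_near. Qed.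

Lemma near_ln_dominated (R : realType) (A s : R) :
  0 < s -> \forall n \near \oo, A * ln (n%:R : R) <= n%:R `^ s.
Proof.
move=> s0; near=> n.
have n1 : 1 <= n%:R :> R by near: n; exact: nbhs_infty_ger.
have n0 : 0 < n%:R :> R by exact: lt_le_trans n1.
have s20 : 0 < s / 2 by rewrite divr_gt0.
(* The logarithm is compared with n^(s / 2), which leaves another n^(s / 2) to absorb the
   constant. *)
have L : ln n%:R <= (s / 2)^-1 * n%:R `^ (s / 2).
  rewrite ler_pdivlMl// -ln_powR; apply/ltW/ln_sublinear; exact: powR_gt0.
apply: (@le_trans _ _ (`|A| * (s / 2)^-1 * n%:R `^ (s / 2))).
  rewrite -mulrA; apply: le_trans (ler_wpM2l (normr_ge0 A) L).
  by rewrite ler_wpM2r ?ln_ge0// ler_norm.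
near: n; apply: near_powR_dominates; lra.
Unshelve. all: by end_near. Qed.

(** A geometric grid of ratio n^eta: the number of levels needed to reach [n] does not depend on
    [n]. *)
Definition weight_level (R : realType) (eta : R) (n l : nat) : R := n%:R `^ (l%:R * eta).

(* Bounds, outside an event of probability [exp(- n^(kappa + eta / 2))], the
   number of vertices with weight at least [weight_level eta n l]. *)
Definition class_bound (R : realType) (alpha kappa eta C : R) (n l : nat) : R :=
  expR 1 * n%:R * (C * weight_level eta n l `^ (- alpha)) + n%:R `^ (kappa + eta / 2).

(** Levels whose typical population, of order n times level^(- alpha), is at most of order n^kappa,
    so that the second term of [class_bound] governs it. The vertices in these classes form the set
    [H]. *)
Definition planted_level (R : realType) (alpha kappa eta : R) (n : nat) : pred nat :=
  fun l => n%:R <= n%:R `^ kappa * weight_level eta n l `^ alpha.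

(** Both terms of [class_bound] are here at most a constant times n^(kappa + eta / 2); a further
    n^(eta / 2) absorbs the constant and the number of levels. *)
Lemma near_planted_levels (R : realType) (alpha kappa eta C : R) (K : nat) :
  0 < eta -> 0 <= C ->
  \forall n \near \oo,
    \sum_(l < K.+1 | planted_level alpha kappa eta n l) class_bound alpha kappa eta C n l
      <= n%:R `^ (kappa + eta).
Proof.
move=> eta0 C0.
near=> n.
have n1 : 1 <= n%:R :> R by near: n; exact: nbhs_infty_ger.
have n0 : 0 < n%:R :> R by exact: lt_le_trans n1.
apply: (@le_trans _ _ (K.+1%:R * (expR 1 * C + 1) * n%:R `^ (kappa + eta / 2))); last first.
  by near: n; apply: near_powR_dominates; lra.
apply: (@le_trans _ _ (\sum_(l < K.+1) (expR 1 * C + 1) * n%:R `^ (kappa + eta / 2))); last first.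
  by rewrite sumr_const card_ord -[leLHS]mulr_natl mulrA.
rewrite big_mkcond; apply: ler_sum => l _; case: ifP => [Hl|_]; last first.
  by rewrite mulr_ge0 ?powR_ge0// addr_ge0// mulr_ge0// expR_ge0.
have yl0 : 0 < weight_level eta n l `^ alpha by rewrite !powR_gt0.
have e1 : n%:R * weight_level eta n l `^ (- alpha) <= n%:R `^ (kappa + eta / 2).
  rewrite powRN ler_pdivrMr//; apply: le_trans Hl _.
  by rewrite ler_wpM2r ?(ltW yl0)//; apply: ler_powR => //; lra.
rewrite /class_bound mulrDl mul1r lerD2r -!mulrA ler_wpM2l ?expR_ge0// mulrCA ler_wpM2l//.
Unshelve. all: by end_near. Qed.

(** Here level^alpha n^kappa < n, so level^alpha times the class bound is O(n^(1 + eta / 2)).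
    Passing to the next level costs n^(eta alpha) <= n^(2 eta), and a last n^(eta / 2) absorbs
    constants. *)
Lemma near_typical_levels (R : realType) (alpha kappa eta C : R) (K : nat) :
  0 < eta -> alpha < 2 -> 0 <= C ->
  \forall n \near \oo,
    \sum_(l < K.+1 | ~~ planted_level alpha kappa eta n l)
      weight_level eta n l.+1 `^ alpha * class_bound alpha kappa eta C n l
        <= n%:R `^ (1 + 3 * eta).
Proof.
move=> eta0 al2 C0.
have eta1 : 1 <= 1 + eta / 2 by lra.
have eta2 : eta * alpha + (1 + eta / 2) <= 1 + eta / 2 + eta * 2.
  by rewrite addrC lerD2l ler_wpM2l ?(ltW al2)// ltW.
near=> n.
have n1 : 1 <= n%:R :> R by near: n; exact: nbhs_infty_ger.
have n0 : 0 < n%:R :> R by exact: lt_le_trans n1.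
apply: (@le_trans _ _ (K.+1%:R * (expR 1 * C + 1) * n%:R `^ (1 + eta / 2 + eta * 2))); last first.
  by near: n; apply: near_powR_dominates; lra.
apply: (@le_trans _ _ (\sum_(l < K.+1) (expR 1 * C + 1) * n%:R `^ (1 + eta / 2 + eta * 2)));
    last first.
  by rewrite sumr_const card_ord -[leLHS]mulr_natl mulrA.
rewrite big_mkcond; apply: ler_sum => l _; case: ifP => [Hl|_]; last first.
  by rewrite mulr_ge0 ?powR_ge0// addr_ge0// mulr_ge0// expR_ge0.
have yl0 : 0 < weight_level eta n l `^ alpha by rewrite !powR_gt0.
have yS : weight_level eta n l.+1 `^ alpha = n%:R `^ (eta * alpha) * weight_level eta n l `^ alpha.
  by rewrite /weight_level -!powRrM -natr1 mulrDl mul1r mulrDl addrC powR_add.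
have yM : weight_level eta n l `^ alpha * class_bound alpha kappa eta C n l <=
    (expR 1 * C + 1) * n%:R `^ (1 + eta / 2).
  rewrite /class_bound mulrDr.
  have -> : weight_level eta n l `^ alpha *
      (expR 1 * n%:R * (C * weight_level eta n l `^ (- alpha))) = expR 1 * C * n%:R.
    by rewrite powRN; field; rewrite gt_eqF.
  rewrite mulrDl mul1r; apply: lerD.
    rewrite ler_wpM2l ?mulr_ge0 ?expR_ge0// -[leLHS]powRr1//.
    exact: ler_powR.
  rewrite powR_add// powR_add// powRr1// mulrA ler_wpM2r ?powR_ge0// mulrC.
  by move: Hl; rewrite /planted_level -ltNge => /ltW.
rewrite yS -mulrA; apply: le_trans (ler_wpM2l (powR_ge0 _ _) yM) _.
rewrite mulrCA ler_wpM2l ?addr_ge0 ?mulr_ge0 ?expR_ge0//.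
by rewrite -powR_add//; exact: ler_powR.
Unshelve. all: by end_near. Qed.

(** The gain is of order n^(2 kappa), whereas [h] and, after division by [n], each of the four error
    terms is at most n^(2 kappa - eta). The three upper bounds on [eta] serve, in this order, the
    terms with three, one and no vertices in [H]; for two, the factor n^(- 7 eta) leaves n^(2 kappa
    - 2 eta). *)
Lemma near_exponent (R : realType) (alpha kappa gamma eta c1 : R) :
  0 < eta -> 0 < c1 -> gamma = 1 + 2 * kappa ->
  4 * eta <= 1 - kappa -> 8 * eta <= kappa -> 10 * eta <= gamma - 3 + 3 / 2 * alpha ->
  \forall n \near \oo,
  forall h S : R, h = n%:R `^ (kappa + eta) -> S = n%:R `^ (1 + 3 * eta) ->
  - (c1 * n%:R `^ gamma / ((expR 1 + 1) * n%:R)) + 3 * expR 1 / n%:R *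
        (h * h * h + h * S * S * n%:R^-1 + n%:R `^ (- (7 * eta)) * (h * h * S)
         + S * S * S * (n%:R `^ (- (alpha / 2))) ^+ 3) <= - h.
Proof.
move=> eta0 c10 gE eta1 eta2 eta3.
have e0 : 0 < expR 1 :> R by exact: expR_gt0.
near=> n => h S hE SE.
have n1 : 1 <= n%:R :> R by near: n; exact: nbhs_infty_ger.
have n0 : 0 < n%:R :> R by exact: lt_le_trans n1.
have nE : n%:R = n%:R `^ 1 :> R by rewrite powRr1// ltW.
have nV : n%:R^-1 = n%:R `^ (-1) :> R by rewrite powR_inv1// ltW.
set Z := n%:R `^ (2 * kappa - eta).
have leZ x : x <= 2 * kappa - eta -> n%:R `^ x <= Z by move=> ?; exact: ler_powR.
have h1 : n%:R^-1 * (h * h * h) <= Z.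
  by rewrite nV hE ?SE -!powR_add//; apply: leZ; lra.
have h2 : n%:R^-1 * (h * S * S * n%:R^-1) <= Z.
  by rewrite nV hE ?SE -!powR_add//; apply: leZ; lra.
have h3 : n%:R^-1 * (n%:R `^ (- (7 * eta)) * (h * h * S)) <= Z.
  by rewrite nV hE ?SE -!powR_add//; apply: leZ; lra.
have h4 : n%:R^-1 * (S * S * S * (n%:R `^ (- (alpha / 2))) ^+ 3) <= Z.
  by rewrite !exprS expr0 mulr1 nV SE -!powR_add//; apply: leZ; lra.
have h5 : h <= Z by rewrite hE; apply: leZ; lra.
(* The 12 e comes from 3 e times four error terms, the 1 from [h]. *)
have main : (12 * expR 1 + 1) * (expR 1 + 1) / c1 * Z <= n%:R `^ (2 * kappa).
  by rewrite /Z; near: n; apply: near_powR_dominates; lra.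
have -> : c1 * n%:R `^ gamma / ((expR 1 + 1) * n%:R) = c1 / (expR 1 + 1) * n%:R `^ (2 * kappa).
  rewrite gE powR_add// powRr1//; field; rewrite gt_eqF//= gt_eqF//; lra.
have cc : 0 < c1 / (expR 1 + 1) by rewrite divr_gt0//; lra.
have := ler_wpM2l (ltW cc) main.
have -> : c1 / (expR 1 + 1) * ((12 * expR 1 + 1) * (expR 1 + 1) / c1 * Z) = 12 * expR 1 * Z + Z.
  by field; rewrite gt_eqF//= gt_eqF//; lra.
have -> : 3 * expR 1 / n%:R * (h * h * h + h * S * S * n%:R^-1 + n%:R `^ (- (7 * eta)) * (h * h * S)
         + S * S * S * (n%:R `^ (- (alpha / 2))) ^+ 3) =
   3 * (expR 1 * (n%:R^-1 * (h * h * h) + n%:R^-1 * (h * S * S * n%:R^-1) +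
   n%:R^-1 * (n%:R `^ (- (7 * eta)) * (h * h * S)) +
   n%:R^-1 * (S * S * S * (n%:R `^ (- (alpha / 2))) ^+ 3))) by ring.
have := lerD (lerD (lerD h1 h2) h3) h4 => /(ler_wpM2l (ltW e0)).
lra.
Unshelve. all: by end_near. Qed.

Lemma near_ln_ge (R : realType) (A : R) : \forall n \near \oo, A <= ln (n%:R : R).
Proof.
near=> n.
have An : expR A <= n%:R by near: n; exact: nbhs_infty_ger.
have n0 : 0 < n%:R :> R by exact: lt_le_trans (expR_gt0 A) An.
by rewrite -ler_expR lnK.
Unshelve. all: by end_near. Qed.

Lemma double_expR_le (R : realType) (Y : R) : 2 * expR (Y - 1) <= expR Y.
Proof.
have -> : expR Y = expR (Y - 1) * expR 1 by rewrite -expRD subrK.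
rewrite mulrC ler_wpM2l ?expR_ge0//.
by have := expR_ge1Dx (1 : R); lra.
Qed.

(** Applies [triangles_tail_le] with [eta = 1 / K], leaving the fraction [e1] of the triangles to
    light pairs. Only the heavy-vertex term has an exponent of order n^kappa ln n; the others are at
    most exp(- n^(kappa + eta / 2)) up to a power of [n]. *)
Lemma near_triangles_upper_aux (d : measure_display) (T : measurableType d)
    (R : realType) (P : probability T R) (mu : R) (W : nat -> {RV P >-> R})
    (G : forall n : nat, T -> rel 'I_n) (K : nat)
    (alpha kappa gamma C a eps e1 b : R) :
  weighted_random_graph mu W G -> iid W -> P [set t | 1 <= W 0%N t] = 1%E ->
  1 <= mu -> 1 < alpha -> alpha < 2 -> 0 <= C ->
  (forall y : R, 1 <= y -> (P [set t | (y <= W 0%N t)%R] <= (C * y `^ (- alpha))%:E)%E) ->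
  0 < kappa -> kappa < 1 -> gamma = 1 + 2 * kappa -> 0 < a -> 0 < e1 -> e1 < 1 -> 0 < eps ->
  b = alpha - (1 - kappa) ->
  (7 <= K)%N ->
  4 / K%:R <= 1 - kappa -> 8 / K%:R <= kappa -> 10 / K%:R <= gamma - 3 + 3 / 2 * alpha ->
  7 * alpha / K%:R < b ->
  Num.sqrt (2 * a) * (7 * alpha / K%:R + e1 * b) <= eps / 2 ->
  \forall n \near \oo,
   (P [set t | (a * n%:R `^ gamma < (triangles (G n t))%:R)%R] <=
     (expR (- ((Num.sqrt (2 * a) * b - eps) * (n%:R `^ kappa * ln n%:R))))%:E)%E.
Proof.
move=> GW iidW W1 mu1 al1 al2 C0 Ptail ka0 ka1 gE a0 e10 e11 eps0 bE K7 K1 K2 K3 K4 K5.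
set eta : R := K%:R^-1 in K1 K2 K3 K4 K5.
set sq := Num.sqrt (2 * a) in K5 *.
have K0 : 0 < K%:R :> R by rewrite ltr0n (leq_trans _ K7).
have eta0 : 0 < eta by rewrite invr_gt0.
have sq0 : 0 < sq by rewrite sqrtr_gt0 mulr_gt0.
have sq2 : sq ^+ 2 = 2 * a by rewrite sqr_sqrtr// ltW// mulr_gt0.
(* The exponent [b] for hubs at the lower threshold n^(1 - 7 eta). *)
pose b' := alpha * (1 - 7 * eta) + kappa - 1.
have b'E : b' = b - 7 * alpha * eta by rewrite /b' bE; ring.
have b'0 : 0 < b' by rewrite b'E subr_gt0.
near=> n.
have n2 : 2 <= n%:R :> R by near: n; exact: nbhs_infty_ger.
have n1 : 1 <= n%:R :> R by lra.
have n0 : 0 < n%:R :> R by lra.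
have nn0 : (0 < n)%N by rewrite -(ltr_nat R).
have lnn : 0 < ln (n%:R : R) by apply: ln_gt0; lra.
pose X := n%:R `^ kappa * ln n%:R.
pose h : R := n%:R `^ (kappa + eta).
pose S : R := n%:R `^ (1 + 3 * eta).
(* The split into [m] and [r] is admissible as (1 - e1)^2 + e1 <= 1. The choice of [c] makes n p exp
   c equal to C n^kappa for heavy vertices, negligible against [c * m]. *)
pose r := e1 * a * n%:R `^ gamma.
pose m := (1 - e1) * sq * n%:R `^ kappa.
pose c := b' * ln n%:R.
pose g : R := n%:R `^ (kappa + eta / 2).
have gh : g <= h by apply: ler_powR => //; lra.
pose M := class_bound alpha kappa eta C n.
pose p l := C * weight_level eta n l `^ (- alpha).
have y0 : weight_level eta n 0 = 1 by rewrite /weight_level mul0r powRr0.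
have homy : {homo weight_level eta n : i j / (i <= j)%N >-> i <= j}.
  by move=> i j ij; apply: ler_powR => //; rewrite ler_wpM2r ?ler_nat// ltW.
have yge1 l : 1 <= weight_level eta n l by rewrite -y0; exact: homy.
have yK : n%:R <= weight_level eta n K by rewrite /weight_level mulfV ?powRr1// gt_eqF.
have yhh : weight_level eta n (K - 7) = n%:R `^ (- (7 * eta)) * n%:R.
  rewrite /weight_level natrB// mulrBl mulfV ?gt_eqF// addrC powR_add// powRr1//.
have Hpl : \sum_(l < K.+1 | planted_level alpha kappa eta n l) M l <= h.
  by rewrite /M /h; near: n; exact: near_planted_levels.
have Htl : \sum_(l < K.+1 | ~~ planted_level alpha kappa eta n l)
    weight_level eta n l.+1 `^ alpha * M l <= S.
  by rewrite /M /S; near: n; exact: near_typical_levels.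
have hn : h <= n%:R.
  by rewrite -[leRHS]powRr1//; apply: ler_powR => //; lra.
have m0 : 0 <= m by rewrite !mulr_ge0 ?powR_ge0 ?ltW//; lra.
have c0 : 0 < c by rewrite mulr_gt0.
have ydl : weight_level eta n (K - 7) <= n%:R `^ (- (7 * eta)) * n%:R by rewrite yhh.
have := triangles_tail_le r GW iidW W1 nn0 mu1 al1 al2 y0 homy yK (fun l => Ptail _ (yge1 l))
  Hpl Htl (powR_ge0 _ _) ydl (leq_subr 7 K) (powR_ge0 _ _) hn m0 c0.
have mr : m ^+ 2 / 2 * n%:R + r <= a * n%:R `^ gamma.
  have -> : m ^+ 2 / 2 * n%:R = (1 - e1) ^+ 2 * a * n%:R `^ gamma.
    rewrite /m !exprMn sq2 gE powR_add// powRr1// (mulrC 2 kappa) powRrM.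
    by rewrite -[2]/(2%:R) powR_mulrn ?powR_ge0//; field.
  rewrite /r -mulrDl ler_wpM2r ?powR_ge0// -mulrDl ler_piMl ?(ltW a0)//; nra.
move=> tail.
apply: (@le_trans _ _ (P [set t | (m ^+ 2 / 2 * n%:R + r < (triangles (G n t))%:R)%R])).
  apply: le_measure; rewrite ?inE.
  - exact: (@measurable_triangles _ _ _ P mu W G n (fun k => a * n%:R `^ gamma < k%:R) GW).
  - exact: (@measurable_triangles _ _ _ P mu W G n (fun k => m ^+ 2 / 2 * n%:R + r < k%:R) GW).
  by move=> t /=; exact: le_lt_trans.
apply: (le_trans tail); rewrite lee_fin => {tail}.
have X0 : 0 <= X by rewrite mulr_ge0 ?powR_ge0// ltW.
have k1 : 1 <= n%:R `^ kappa by have := ler_powR n1 (ltW ka0); rewrite powRr0.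
set Y := - ((sq * b - eps) * _).
have T1 : expR (- (c * m) + n%:R * (C * weight_level eta n (K - 7) `^ (- alpha)) *
    (expR c - 1)) <= expR (Y - 1).
  rewrite ler_expR.
  have ec : expR c = n%:R `^ b' by rewrite /powR gt_eqF.
  have p0 : 0 <= n%:R * (C * weight_level eta n (K - 7) `^ (- alpha)).
    by rewrite !mulr_ge0// powR_ge0.
  have pe : n%:R * (C * weight_level eta n (K - 7) `^ (- alpha)) * expR c = C * n%:R `^ kappa.
    have -> : n%:R `^ kappa = n%:R * (weight_level eta n (K - 7) `^ (- alpha)) * expR c.
      have -> : weight_level eta n (K - 7) = n%:R `^ (1 - 7 * eta).
        by rewrite yhh mulrC powR_add// powRr1.
      transitivity (n%:R `^ 1 * n%:R `^ ((1 - 7 * eta) * - alpha) * n%:R `^ b').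
        by rewrite -!powR_add//; congr (_ `^ _); rewrite /b'; ring.
      by rewrite powRr1// powRrM ec.
    by ring.
  have cm : c * m = b' * (1 - e1) * sq * X by rewrite /c /m /X; ring.
  have coef : (sq * b - eps / 2) * X <= b' * (1 - e1) * sq * X.
    rewrite ler_wpM2r// b'E.
    have : 0 <= sq * (e1 * (7 * alpha * eta)) by rewrite !mulr_ge0// ?ltW//; lra.
    lra.
  have CX : (C + 1) * n%:R `^ kappa <= eps / 2 * X.
    rewrite /X mulrCA [leRHS]mulrC ler_wpM2r ?powR_ge0//.
    rewrite -ler_pdivrMl ?divr_gt0//; near: n; exact: near_ln_ge.
  rewrite mulrBr pe cm mulr1 /Y -/X; lra.
(* The first term of [class_bound] is e n p, which outweighs n p (e - 1) in the exponent. *)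
have T2 : \sum_(l < K.+1) expR (- M l + n%:R * p l * (expR 1 - 1)) <= K.+1%:R * expR (- g).
  rewrite mulr_natl -[in leRHS](card_ord K.+1) -sumr_const; apply: ler_sum => l _; rewrite ler_expR.
  rewrite /M /class_bound -/(p l) -/g.
  have : 0 <= n%:R * p l by rewrite !mulr_ge0// powR_ge0.
  lra.
have T3 : n%:R ^+ 2 * expR (- h) <= n%:R ^+ 2 * expR (- g).
  by rewrite ler_wpM2l ?exprn_ge0// ler_expR lerN2.
set Z := expR (- (r / _) + _).
have T4 : Z <= expR (- g).
  rewrite /Z ler_expR; apply: (@le_trans _ _ (- h)); last by rewrite lerN2.
  have near_exp : forall h S : R, h = n%:R `^ (kappa + eta) -> S = n%:R `^ (1 + 3 * eta) ->
  - (e1 * a * n%:R `^ gamma / ((expR 1 + 1) * n%:R)) + 3 * expR 1 / n%:R *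
        (h * h * h + h * S * S * n%:R^-1 + n%:R `^ (- (7 * eta)) * (h * h * S)
         + S * S * S * (n%:R `^ (- (alpha / 2))) ^+ 3) <= - h.
    by near: n; apply: near_exponent => //; rewrite mulr_gt0.
  exact: near_exp.
(* The prefactor counts K + 1 classes, one light-triangle term and n^2 codegrees; [g] eventually
   exceeds any multiple of n^kappa ln n. *)
have T5 : (K.+2%:R + n%:R ^+ 2) * expR (- g) <= expR (Y - 1).
  have Kn : K.+2%:R + n%:R ^+ 2 <= expR (K.+2%:R + 2 * ln (n%:R : R)).
    rewrite expRD [in leRHS]expRM_natl lnK//.
    have := expR_ge1Dx (K.+2%:R : R).
    have : 1 <= n%:R ^+ 2 :> R by rewrite exprn_ege1.
    have : 0 <= K.+2%:R :> R by [].
    set k2 := K.+2%:R; set q := n%:R ^+ 2; set ee := expR k2; nra.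
  apply: le_trans (ler_wpM2r (expR_ge0 _) Kn) _.
  rewrite -expRD ler_expR.
  have X1 : ln n%:R <= X by rewrite /X ler_peMl// ltW.
  have g1 : 2 * (K.+2%:R + 1) <= g.
    have : 2 * (K.+2%:R + 1) * n%:R `^ 0 <= g.
      by rewrite /g; near: n; apply: near_powR_dominates; lra.
    by rewrite powRr0 mulr1.
  have g2 : 2 * (2 + sq * b) * X <= g.
    rewrite /X /g powR_add// mulrCA ler_wpM2l ?powR_ge0//.
    by near: n; apply: near_ln_dominated; lra.
  have eX : 0 <= eps * X by rewrite mulr_ge0// ltW.
  rewrite /Y -/X; clear Hpl Htl T1 T2 T3 T4 mr ydl hn; lra.
apply: le_trans (double_expR_le Y); rewrite [leRHS]mulr_natl mulr2n -[leLHS]addrA.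
apply: lerD T1 (le_trans _ T5).
apply: le_trans (lerD T2 (lerD T3 T4)) _.
by rewrite -(natr1 K.+1) !mulrDl mul1r addrAC addrA.
Unshelve. all: by end_near. Qed.

(** * Mean and tail of a single weight *)

Lemma expectation_ge1 (d : measure_display) (T : measurableType d) (R : realType)
    (P : probability T R) (X : {RV P >-> R}) :
  P [set t | 1 <= X t] = 1%E -> (1 <= 'E_P[X])%E.
Proof.
move=> X1.
have mX : measurable_fun setT (X : T -> R) by [].
have mO : measurable [set t | 1 <= X t].
  rewrite -[X in measurable X]setTI; apply: (mX measurableT [set w | 1 <= w]).
  exact: measurable_ge.
have mmax : measurable_fun setT (fun t => Num.max (X t) 1).
  by apply: measurable_maxr => //; exact: measurable_cst.
(* Almost surely [X] equals its maximum with 1, and the latter is at least 1 everywhere. *)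
rewrite unlock (_ : (\int[P]_t (X t)%:E = \int[P]_t (Num.max (X t) 1)%:E)%E).
  rewrite -(expectation_cst P 1) unlock.
  apply: ge0_le_integral => //.
  - exact/measurable_EFinP/measurable_cst.
  - exact/measurable_EFinP.
  - by move=> t _; rewrite lee_fin le_max lexx orbT.
apply: ae_eq_integral => //; [exact/measurable_EFinP|exact/measurable_EFinP|].
exists (~` [set t | 1 <= X t]); split.
- exact: measurableC.
- by rewrite -[LHS]/(P _) probability_setC// X1 subee.
move=> t /= H Xt; apply: H => _.
by rewrite (max_idPl Xt).
Qed.

(** Passes between the strict tail in [ccdf] and the non-strict tails of the weight classes, at the
    price of a shifted argument. *)
Lemma ccdf_le_ge (d : measure_display) (T : measurableType d) (R : realType)
    (P : probability T R) (X : {RV P >-> R}) (x y : R) :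
  x < y -> (P [set t | (y <= X t)%R] <= ccdf X x <= P [set t | (x <= X t)%R])%E.
Proof.
move=> xy.
have mX : measurable_fun setT (X : T -> R) by [].
have mge z : measurable [set t | z <= X t].
  rewrite -[X in measurable X]setTI; apply: (mX measurableT [set w | z <= w]).
  exact: measurable_ge.
have mgt : measurable (X @^-1` `]x, +oo[).
  by rewrite -[X in measurable X]setTI; exact: (mX measurableT _ (measurable_itv _)).
have -> : ccdf X x = P (X @^-1` `]x, +oo[) by [].
apply/andP; split; apply: le_measure; rewrite ?inE//.
  by move=> t /= yX; rewrite in_itv/= andbT (lt_le_trans xy).
by move=> t /=; rewrite in_itv/= andbT => /ltW.
Qed.

(** For large [y] the asymptotics at [y / 2] give the constant 2 C 2^alpha; for y <= 2 M' the
    trivial bound 1 is paid for by (2 M')^alpha. *)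
Lemma weight_tail_upper (d : measure_display) (T : measurableType d) (R : realType)
    (P : probability T R) (X : {RV P >-> R}) (alpha C : R) :
  0 < alpha -> 0 < C ->
  fine (ccdf X x) / (C * x `^ (- alpha)) @[x --> +oo] --> (1 : R) ->
  exists2 C' : R, 0 <= C' &
    forall y : R, 1 <= y -> (P [set t | (y <= X t)%R] <= (C' * y `^ (- alpha))%:E)%E.
Proof.
move=> al0 C0 tail.
have [M [Mr HM]] : \forall x \near +oo, fine (ccdf X x) / (C * x `^ (- alpha)) < 2.
  by apply: (cvgr_lt (1 : R)) => //; rewrite ltr1n.
pose M' := Num.max M 1.
have M'1 : 1 <= M' by rewrite le_max lexx orbT.
exists (2 * C * 2 `^ alpha + (2 * M') `^ alpha).
  by rewrite addr_ge0 ?mulr_ge0 ?powR_ge0// ltW.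
move=> y y1.
have y0 : 0 < y by exact: lt_le_trans y1.
have yp : 0 < y `^ (- alpha) by exact: powR_gt0.
have [big|small] := ltP M' (y / 2); last first.
  apply: (@le_trans _ _ 1%E).
    apply: probability_le1.
    have mX : measurable_fun setT (X : T -> R) by [].
    rewrite -[X in measurable X]setTI; apply: (mX measurableT [set w | y <= w]).
    exact: measurable_ge.
  rewrite lee_fin mulrDl ler_wpDl ?mulr_ge0 ?powR_ge0 ?(ltW C0)//.
  rewrite powRN -ler_pdivrMr ?invr_gt0 ?powR_gt0// div1r invrK.
  apply: ge0_ler_powR; rewrite ?nnegrE ?(ltW al0) ?(ltW y0)//; last by lra.
  by rewrite mulr_ge0// (le_trans ler01).
have y20 : 0 < y / 2 by rewrite divr_gt0.
have yy : y / 2 < y by lra.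
have /andP[le1 _] := ccdf_le_ge X yy.
apply: (le_trans le1).
have fin : ccdf X (y / 2) \is a fin_num by exact: fin_num_measure.
rewrite -(fineK fin) lee_fin.
have My : M < y / 2 by apply: le_lt_trans big; rewrite le_max lexx.
have := HM _ My; rewrite /= ltr_pdivrMr; last by rewrite mulr_gt0// powR_gt0.
move=> /ltW/le_trans; apply.
have e : (y / 2) `^ (- alpha) = 2 `^ alpha * y `^ (- alpha).
  rewrite powRM ?(ltW y0) ?invr_ge0// mulrC; congr (_ * _).
  by rewrite -(@powR_inv1 _ 2)// -powRrM mulN1r opprK.
rewrite [leRHS]mulrDl e; apply: ler_wpDr; first by rewrite mulr_ge0 ?powR_ge0.
by rewrite !mulrA.
Qed.

Lemma weight_tail_lower (d : measure_display) (T : measurableType d) (R : realType)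
    (P : probability T R) (X : {RV P >-> R}) (alpha C : R) :
  0 < C ->
  fine (ccdf X x) / (C * x `^ (- alpha)) @[x --> +oo] --> (1 : R) ->
  \forall x \near +oo, ((C / 2 * x `^ (- alpha))%:E <= P [set t | (x <= X t)%R])%E.
Proof.
move=> C0 tail.
have half : \forall x \near +oo, 2^-1 < fine (ccdf X x) / (C * x `^ (- alpha)).
  by apply: (cvgr_gt (1 : R)) => //; lra.
near=> x.
have x0 : 0 < x by near: x; exact: nbhs_pinfty_gt.
have xx : x < x + 1 by rewrite ltrDl.
have /andP[_] := ccdf_le_ge X xx.
apply: le_trans.
have fin : ccdf X x \is a fin_num by exact: fin_num_measure.
rewrite -(fineK fin) lee_fin.
have : 2^-1 < fine (ccdf X x) / (C * x `^ (- alpha)) by near: x.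
rewrite ltr_pdivlMr; last by rewrite mulr_gt0// powR_gt0.
by move/ltW/(le_trans _); apply; rewrite mulrA (mulrC C).
Unshelve. all: by end_near. Qed.

Lemma near_triangles_upper (d : measure_display) (T : measurableType d)
    (R : realType) (P : probability T R) (mu : R) (W : nat -> {RV P >-> R})
    (G : forall n : nat, T -> rel 'I_n)
    (alpha kappa gamma C a eps b : R) :
  weighted_random_graph mu W G -> iid W -> P [set t | 1 <= W 0%N t] = 1%E ->
  1 <= mu -> 1 < alpha -> alpha < 2 -> 0 <= C ->
  (forall y : R, 1 <= y -> (P [set t | (y <= W 0%N t)%R] <= (C * y `^ (- alpha))%:E)%E) ->
  0 < kappa -> kappa < 1 -> gamma = 1 + 2 * kappa -> 3 - 3 / 2 * alpha < gamma ->
  0 < a -> 0 < eps -> b = alpha - (1 - kappa) ->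
  \forall n \near \oo,
   (P [set t | (a * n%:R `^ gamma < (triangles (G n t))%:R)%R] <=
     (expR (- ((Num.sqrt (2 * a) * b - eps) * (n%:R `^ kappa * ln n%:R))))%:E)%E.
Proof.
move=> GW iidW W1 mu1 al1 al2 C0 Ptail ka0 ka1 gE g3 a0 eps0 bE.
set sq := Num.sqrt (2 * a).
have sq0 : 0 < sq by rewrite sqrtr_gt0 mulr_gt0.
have b0 : 0 < b by rewrite bE; lra.
have sb0 : 0 < sq * b by rewrite mulr_gt0.
(* Keeps the loss [sq * (e1 * b)] below [eps / 4]; another quarter is left to the choice of [K]. *)
pose e1 := eps / (4 * (sq * b) + 2 * eps).
have D0 : 0 < 4 * (sq * b) + 2 * eps by lra.
have e10 : 0 < e1 by rewrite divr_gt0.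
have e11 : e1 < 1 by rewrite ltr_pdivrMr//; lra.
have e1b : sq * (e1 * b) <= eps / 4.
  rewrite mulrCA /e1 mulrAC ler_pdivrMr//.
  have : 0 <= eps * eps by rewrite mulr_ge0// ltW.
  lra.
have k1 : 0 < 1 - kappa by lra.
have g0 : 0 < gamma - 3 + 3 / 2 * alpha by lra.
(* The sum of all lower bounds required of [K]; the last summand makes [sq * (7 * alpha / K)] at
   most [eps / 4]. *)
pose B := 7 + 4 / (1 - kappa) + 8 / kappa + 10 / (gamma - 3 + 3 / 2 * alpha)
  + 7 * alpha / b + 28 * alpha * sq / eps.
have B1 : 0 < 4 / (1 - kappa) by rewrite divr_gt0.
have B2 : 0 < 8 / kappa by rewrite divr_gt0.
have B3 : 0 < 10 / (gamma - 3 + 3 / 2 * alpha) by rewrite divr_gt0.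
have B4 : 0 < 7 * alpha / b by rewrite divr_gt0//; lra.
have B5 : 0 < 28 * alpha * sq / eps by rewrite divr_gt0// mulr_gt0//; lra.
pose K := Num.bound B.
have BK : B < K%:R by apply: archi_boundP; rewrite /B; lra.
have K0 : 0 < K%:R :> R by rewrite /B in BK; lra.
have aux (x z : R) : 0 < z -> x / z < K%:R -> x / K%:R < z.
  by move=> z0; rewrite ltr_pdivrMr// ltr_pdivrMr// mulrC.
apply: (@near_triangles_upper_aux _ _ _ P mu W G K alpha kappa gamma C a eps e1 b) => //.
- by rewrite -(ler_nat R); rewrite /B in BK; lra.
- by apply/ltW/aux => //; rewrite /B in BK; lra.
- by apply/ltW/aux => //; rewrite /B in BK; lra.
- by apply/ltW/aux => //; rewrite /B in BK; lra.
- by apply: aux => //; rewrite /B in BK; lra.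
rewrite -/sq mulrDr.
have : 28 * alpha * sq / K%:R < eps by apply: aux => //; rewrite /B in BK; lra.
have -> : sq * (7 * alpha / K%:R) = (28 * alpha * sq / K%:R) / 4.
  by field; rewrite gt_eqF.
lra.
Qed.

(** * Lower bound *)

Lemma bernoulli_le (R : realDomainType) (p : R) (m : nat) :
  0 <= p <= 1 -> 1 - m%:R * p <= (1 - p) ^+ m.
Proof.
move=> /andP[p0 p1]; elim: m => [|m IH]; first by rewrite mul0r subr0 expr0.
have q0 : 0 <= 1 - p by lra.
have := ler_wpM2l q0 IH; rewrite -exprS; apply: le_trans.
rewrite -natr1; have : 0 <= m%:R * (p * p) by rewrite !mulr_ge0.
lra.
Qed.

(** A division-free form of the bound (n / k)^k on the binomial coefficient. The induction uses the
    absorption identity and (n + 1) k <= n (k + 1). *)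
Lemma bin_ge_expn (n k : nat) : (k <= n)%N -> (n ^ k <= 'C(n, k) * k ^ k)%N.
Proof.
elim: k n => [|k IH] [|n] //.
rewrite ltnS => kn.
rewrite !expnS mulnA (mulnC 'C(_, _)) -mul_bin_diag -mulnA leq_mul2l /=.
have [->|k0] := posnP k; first by rewrite !expn0 bin0.
have kk : (0 < k ^ k)%N by rewrite expn_gt0 k0.
rewrite -(leq_pmul2r kk).
apply: (@leq_trans (n ^ k * k.+1 ^ k)).
  rewrite -!expnMn leq_exp2r// mulSn mulnS leq_add2r//.
apply: leq_trans (leq_mul (IH _ kn) (leqnn _)) _.
by rewrite mulnAC.
Qed.

(** For each k-set [S], [D S] says that exactly [S] has weights at least mu n and that all edges at
    [S] are present. The other weights being at least 1, these edges have conditional probability 1,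
    so [D S] is as likely as its weight pattern. Disjointness of these events yields the binomial
    probability. *)
Lemma triangles_tail_ge (d : measure_display) (T : measurableType d)
    (R : realType) (P : probability T R) (mu : R) (W : nat -> {RV P >-> R})
    (G : forall n : nat, T -> rel 'I_n) (n k : nat) (a0 p : R) :
  weighted_random_graph mu W G -> iid W -> P [set t | 1 <= W 0%N t] = 1%E ->
  0 < mu -> (0 < n)%N -> (k <= n)%N ->
  a0 < ('C(k, 2) * (n - k))%N%:R -> P [set t | mu * n%:R <= W 0%N t] = p%:E ->
  (('C(n, k)%:R * p ^+ k * (1 - p) ^+ (n - k))%:E <=
    P [set t | (a0 < (triangles (G n t))%:R)%R])%E.
Proof.
move=> GW iidW W1 mu0 n0 kn a0k Pp.
have muN : 0 < mu * n%:R by rewrite mulr_gt0// ltr0n.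
set x0 := mu * n%:R in Pp muN.
pose B (S : {set 'I_n}) (i : 'I_n) : set R :=
  (if i \in S then [set w | x0 <= w] else ~` [set w | x0 <= w]) `&` [set w | 1 <= w].
have mB S i : measurable (B S i).
  apply: measurableI; last exact: measurable_ge.
  by case: ifP => _; [exact: measurable_ge|apply: measurableC; exact: measurable_ge].
pose A S := [set t | forall i : 'I_n, B S i (W i.+1 t)].
have sA S : weight_sigma W n (A S) by exact: weight_sigma_forall.
have mge (x : R) : measurable [set t | x <= W 0%N t] by exact: measurable_weight_ge.
have PB S i : P [set t | B S i (W 0%N t)] = (if i \in S then p else 1 - p)%:E.
  rewrite /B; case: ifP => iS.
    by rewrite -Pp -(probability_setIr (mge x0) (mge 1) W1).
  have := probability_setIr (measurableC (mge x0)) (mge 1) W1.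
  by rewrite probability_setC// Pp -EFinB.
have PA (S : {set 'I_n}) : #|S| = k -> P (A S) = (p ^+ k * (1 - p) ^+ (n - k))%:E.
  move=> Sk.
  have := @iid_forall _ _ _ P W n [set: 'I_n]%SET (B S) iidW (mB S).
  rewrite (_ : [set t | _] = A S); last first.
    by apply/seteqP; split => t /= H i; [apply: H; rewrite inE|move=> _; exact: H].
  move=> ->; under eq_bigr do rewrite PB.
  rewrite prodEFin; congr EFin.
  rewrite (eq_bigl xpredT); last by move=> i; rewrite inE.
  rewrite (bigID (mem S)) /=; congr (_ * _).
    under eq_bigr do rewrite ifT//.
    by rewrite prodr_const Sk.
  rewrite (eq_bigr (fun=> 1 - p)); last by move=> i /negbTE ->.
  rewrite (eq_bigl (mem (~: S))); last by move=> i; rewrite !inE.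
  by rewrite prodr_const cardsCs finset.setCK card_ord Sk.
pose E (S : {set 'I_n}) :=
  [set e : 'I_n * 'I_n | (e.1 < e.2)%N && ((e.1 \in S) || (e.2 \in S))]%SET.
have ltE S e : e \in E S -> (e.1 < e.2)%N by rewrite inE => /andP[].
have probE S t e : A S t -> e \in E S -> edge_prob mu W e.1 e.2 t = 1.
  move=> At; rewrite inE => /andP[_ eS]; rewrite /edge_prob; apply/min_idPr.
  rewrite ler_pdivlMr// mul1r -/x0.
  have [Bi /= Wi] := At e.1; have [Bj /= Wj] := At e.2.
  case/orP: eS => eS; [move: Bi|move: Bj]; rewrite eS /= => le.
    by rewrite -[leLHS]mulr1; apply: ler_pM => //; exact: ltW.
  by rewrite -[leLHS]mul1r; apply: ler_pM => //; exact: ltW.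
pose D S := A S `&` [set t | forall e, e \in E S -> G n t e.1 e.2].
have PD S : P (D S) = P (A S) by exact: (edges_sure GW (sA S) (ltE S) (probE S)).
have mG x y : measurable [set t | G n t x y] by exact: adj_measurable GW _ _ _.
have mA S : measurable (A S) by exact: weight_sigma_measurable (sA S).
have mD S : measurable (D S).
  by apply: measurableI => //; apply: measurable_all_bool.
have dD S S' t : D S t -> D S' t -> S = S'.
  move=> [At _] [At' _]; apply/setP => i.
  have [Bi _] := At i; have [Bi' _] := At' i.
  by move: Bi Bi'; case: (i \in S); case: (i \in S').
apply: (@le_trans _ _ (P (\big[setU/set0]_(S : {set 'I_n} | #|S| == k) D S))).
  rewrite measure_disjoint_bigsetU//.
  rewrite (eq_bigr (fun=> (p ^+ k * (1 - p) ^+ (n - k))%:E)); last first.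
    by move=> S /eqP Sk; rewrite PD PA.
  rewrite sumEFin lee_fin sumr_const.
  rewrite (_ : #|_| = 'C(n, k)) -?mulrA ?mulr_natl//.
  rewrite -[in RHS](card_ord n) -(card_draws 'I_n k) cardsE.
  by apply: eq_card => S.
apply: le_measure; rewrite ?inE.
- exact: bigsetU_measurable.
- exact: (@measurable_triangles _ _ _ P mu W G n (fun j => a0 < j%:R) GW).
move=> t; rewrite -bigcup_pred => -[S /eqP Sk [At Gt]] /=.
apply: lt_le_trans a0k _; rewrite ler_nat -Sk; apply: triangles_ge.
  exact: adj_sym GW _ _.
move=> i j iS ij.
move: (ij); rewrite -(inj_eq val_inj) neq_ltn => /orP[] lt.
  by apply: (Gt (i, j)); rewrite inE /= lt iS.
by rewrite (adj_sym GW); apply: (Gt (j, i)); rewrite inE /= lt iS orbT.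
Qed.

(** Plants slightly more than sqrt(2a) n^kappa hubs. The binomial probability is at least (n p /
    k)^k / 2, and n p / k is at least a constant times n^(- b). *)
Lemma near_triangles_lower (d : measure_display) (T : measurableType d)
    (R : realType) (P : probability T R) (mu : R) (W : nat -> {RV P >-> R})
    (G : forall n : nat, T -> rel 'I_n)
    (alpha kappa gamma c C a eps b : R) :
  weighted_random_graph mu W G -> iid W -> P [set t | 1 <= W 0%N t] = 1%E ->
  1 <= mu -> 1 < alpha -> 0 < c ->
  (forall y : R, 1 <= y -> (P [set t | (y <= W 0%N t)%R] <= (C * y `^ (- alpha))%:E)%E) ->
  (\forall x \near +oo, ((c * x `^ (- alpha))%:E <= P [set t | (x <= W 0%N t)%R])%E) ->
  0 < kappa -> kappa < 1 -> gamma = 1 + 2 * kappa ->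
  0 < a -> 0 < eps -> b = alpha - (1 - kappa) ->
  \forall n \near \oo,
    ((expR (- ((Num.sqrt (2 * a) * b + eps) * (n%:R `^ kappa * ln n%:R))))%:E <=
     P [set t | (a * n%:R `^ gamma < (triangles (G n t))%:R)%R])%E.
Proof.
move=> GW iidW W1 mu1 al1 c0 up [M0 [_ low]] ka0 ka1 gE a0 eps0 bE.
set sq := Num.sqrt (2 * a).
have sq0 : 0 < sq by rewrite sqrtr_gt0 mulr_gt0.
have sq2 : sq ^+ 2 = 2 * a by rewrite sqr_sqrtr// ltW// mulr_gt0.
have b0 : 0 < b by rewrite bE; lra.
have sb0 : 0 < sq * b by rewrite mulr_gt0.
have mu0 : 0 < mu by exact: lt_le_trans mu1.
(* The slack in the number of hubs costs at most [eps / 2]; the other half of [eps] absorbs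
   constants. *)
pose e2 := eps / (4 * (sq * b) + eps).
have D0 : 0 < 4 * (sq * b) + eps by lra.
have e20 : 0 < e2 by rewrite divr_gt0.
have e2b : 2 * e2 * (sq * b) <= eps / 2.
  rewrite (_ : 2 * e2 * (sq * b) = (2 * eps * (sq * b)) / (4 * (sq * b) + eps)); last first.
    by rewrite /e2; field; rewrite gt_eqF.
  rewrite ler_pdivrMr//.
  have : 0 <= eps * eps by rewrite mulr_ge0// ltW.
  lra.
pose k2c := (1 + 2 * e2) * sq.
have k2c0 : 0 < k2c by rewrite mulr_gt0//; lra.
pose c3 := c * mu `^ (- alpha) / k2c.
have c30 : 0 < c3 by rewrite divr_gt0// mulr_gt0// powR_gt0.
have e1 : expR (-1) <= 1 / 2 :> R.
  rewrite expRN div1r lef_pV2 ?posrE ?expR_gt0//.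
  by have := expR_ge1Dx (1 : R); lra.
near=> n.
have n2 : 2 <= n%:R :> R by near: n; exact: nbhs_infty_ger.
have n1 : 1 <= n%:R :> R by lra.
have n0 : 0 < n%:R :> R by lra.
have nn0 : (0 < n)%N by rewrite -(ltr_nat R).
have lnn : 0 < ln (n%:R : R) by apply: ln_gt0; lra.
pose X := n%:R `^ kappa * ln n%:R.
have k1 : 1 <= n%:R `^ kappa by have := ler_powR n1 (ltW ka0); rewrite powRr0.
pose z := (1 + e2) * sq * n%:R `^ kappa.
have z0 : 0 <= z by rewrite !mulr_ge0// ?ltW//; lra.
(* Adding 2 ensures [z < k - 1], so that k (k - 1) / 2 exceeds z^2 / 2. *)
pose k := (Num.truncn z).+2.
have /andP[tr1 tr2] := truncn_itv z0.
have kz1 : z < k%:R - 1 by rewrite /k -natr1 addrK.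
have e2n : 2 <= e2 * sq * n%:R `^ kappa.
  have es0 : 0 < e2 * sq by rewrite mulr_gt0.
  have : (e2 * sq)^-1 * 2 * n%:R `^ 0 <= n%:R `^ kappa.
    by near: n; exact: near_powR_dominates.
  by rewrite powRr0 mulr1 ler_pdivrMl.
have kz2 : k%:R <= k2c * n%:R `^ kappa.
  rewrite /k2c /k -!natr1; move: tr1 e2n; rewrite /z; lra.
have kpos : (0 < k)%N by [].
clearbody k.
have kn' : k%:R <= e2 / (1 + e2) * n%:R.
  apply: (le_trans kz2); rewrite -ler_pdivrMl ?divr_gt0//; last by lra.
  rewrite mulrA -[leRHS]powRr1//; near: n; exact: near_powR_dominates.
(* The factor [1 + e2] lost by excluding third vertices among the hubs is recovered from (1 + e2)^2
   in z^2. *)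
have nk : n%:R / (1 + e2) <= n%:R - k%:R.
  have -> : n%:R / (1 + e2) = n%:R - e2 / (1 + e2) * n%:R by field; rewrite gt_eqF//; lra.
  by rewrite lerD2l lerN2.
have kn : (k <= n)%N.
  rewrite -(ler_nat R) -subr_ge0; apply: le_trans nk; rewrite divr_ge0//; lra.
have bin : a * n%:R `^ gamma < ('C(k, 2) * (n - k))%N%:R.
  have b2 : z ^+ 2 / 2 < 'C(k, 2)%:R.
    rewrite ltr_pdivrMr// -natrM -[2%N]/(2`!) bin_ffact ffactnSr ffactn1 natrM.
    rewrite natrB//; apply: (@lt_le_trans _ _ ((k%:R - 1) * (k%:R - 1))).
      by rewrite expr2; apply: ltr_pM.
    by rewrite ler_wpM2r//; move: kz1; lra.
  rewrite natrM natrB//.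
  apply: (@lt_le_trans _ _ ('C(k, 2)%:R * (n%:R / (1 + e2)))); last by rewrite ler_wpM2l.
  have nd : 0 < n%:R / (1 + e2) by rewrite divr_gt0//; lra.
  apply: le_lt_trans (_ : z ^+ 2 / 2 * (n%:R / (1 + e2)) < _); last by rewrite ltr_pM2r.
  have -> : z ^+ 2 / 2 * (n%:R / (1 + e2)) = (1 + e2) * (a * n%:R `^ gamma).
    rewrite /z !exprMn sq2 gE powR_add// powRr1// (mulrC 2 kappa) powRrM.
    rewrite -[2]/(2%:R) powR_mulrn ?powR_ge0//; field; rewrite gt_eqF//; lra.
  rewrite ler_peMl ?mulr_ge0 ?powR_ge0 ?(ltW a0)//; lra.
pose p := fine (P [set t | mu * n%:R <= W 0%N t]).
have Pp : P [set t | mu * n%:R <= W 0%N t] = p%:E.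
  by rewrite fineK//; apply: fin_num_measure; exact: measurable_weight_ge.
have mun1 : 1 <= mu * n%:R by rewrite mulr_ege1.
have p0 : 0 <= p by rewrite -lee_fin -Pp.
have p1 : p <= 1 by rewrite -lee_fin -Pp; apply: probability_le1; exact: measurable_weight_ge.
have powmu : (mu * n%:R) `^ (- alpha) = mu `^ (- alpha) * n%:R `^ (- alpha).
  by rewrite powRM// ltW.
have pup : p <= C * (mu `^ (- alpha) * n%:R `^ (- alpha)).
  by rewrite -lee_fin -Pp -powmu; exact: up.
have plow : c * (mu `^ (- alpha) * n%:R `^ (- alpha)) <= p.
  rewrite -lee_fin -Pp -powmu; apply: low.
  apply: (@lt_le_trans _ _ (n%:R)); last by rewrite ler_peMl// ltW.
  near: n; exact: nbhs_infty_gtr.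
(* The product is at most of order n^(1 - alpha), which tends to 0. *)
have np : n%:R * p <= 1 / 2.
  apply: le_trans (ler_wpM2l (ltW n0) pup) _.
  have -> : n%:R * (C * (mu `^ (- alpha) * n%:R `^ (- alpha))) =
      C * mu `^ (- alpha) * n%:R `^ (1 - alpha).
    by rewrite powR_add// powRr1//; ring.
  rewrite ler_pdivlMr// mulrC mulrA -[leRHS](powRr0 n%:R).
  by near: n; apply: near_powR_dominates; lra.
apply: le_trans (triangles_tail_ge GW iidW W1 mu0 nn0 kn bin Pp); rewrite lee_fin.
have k0 : 0 < k%:R :> R by rewrite ltr0n.
have half : 1 / 2 <= (1 - p) ^+ (n - k).
  have p01 : 0 <= p <= 1 by rewrite p0.
  apply: le_trans (bernoulli_le (n - k) p01).
  have : (n - k)%N%:R * p <= n%:R * p by rewrite ler_wpM2r// ler_nat leq_subr.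
  lra.
have bk : (n%:R * p / k%:R) ^+ k <= 'C(n, k)%:R * p ^+ k.
  rewrite expr_div_n exprMn ler_pdivrMr ?exprn_gt0// [leRHS]mulrAC ler_wpM2r ?exprn_ge0//.
  by rewrite -!natrX -natrM ler_nat bin_ge_expn.
have kd0 : 0 < k2c * n%:R `^ kappa by exact: mulr_gt0 k2c0 (powR_gt0 _ n0).
have base : c3 * n%:R `^ (- b) <= n%:R * p / k%:R.
  apply: (@le_trans _ _ (n%:R * p / (k2c * n%:R `^ kappa))); last first.
    by rewrite ler_wpM2l ?mulr_ge0// lef_pV2.
  rewrite ler_pdivlMr//.
  have -> : c3 * n%:R `^ (- b) * (k2c * n%:R `^ kappa) =
      n%:R * (c * (mu `^ (- alpha) * n%:R `^ (- alpha))).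
    have -> : n%:R `^ (- alpha) = n%:R `^ (- b) * n%:R `^ kappa * n%:R `^ (-1).
      by rewrite -!powR_add//; congr (_ `^ _); rewrite bE; ring.
    by rewrite powR_inv1// /c3; field; rewrite !(gt_eqF k2c0, gt_eqF n0).
  by rewrite ler_wpM2l.
have cN0 : 0 < c3 * n%:R `^ (- b) by rewrite mulr_gt0// powR_gt0.
have bk2 : expR (k%:R * (ln c3 - b * ln n%:R)) <= 'C(n, k)%:R * p ^+ k.
  apply: le_trans bk; rewrite expRM_natl lerXn2r ?nnegrE ?expR_ge0//.
    by rewrite divr_ge0// mulr_ge0.
  apply: le_trans base; rewrite expRD lnK ?posrE//.
  by rewrite -mulNr /powR gt_eqF.
apply: (@le_trans _ _ (expR (k%:R * (ln c3 - b * ln n%:R)) * (1 / 2))); last first.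
  by apply: ler_pM; rewrite ?expR_ge0//.
apply: (@le_trans _ _ (expR (k%:R * (ln c3 - b * ln n%:R)) * expR (-1))); last first.
  by rewrite ler_wpM2l ?expR_ge0.
rewrite -expRD ler_expR -/X.
have Lc : - `|ln c3| <= ln c3 by rewrite lerNl ler_normr lexx orbT.
have kL : - (k2c * n%:R `^ kappa * (`|ln c3| + b * ln n%:R)) <= k%:R * (ln c3 - b * ln n%:R).
  apply: (@le_trans _ _ (- (k%:R * (`|ln c3| + b * ln n%:R)))).
    by rewrite lerN2 ler_wpM2r// addr_ge0// mulr_ge0// ltW.
  by rewrite -mulrN ler_wpM2l// opprD lerD2r.
(* Terms of order n^kappa in the exponent lack the factor ln n and are eventually negligible. *)
have lnb : (k2c * `|ln c3| + 1) * n%:R `^ kappa <= eps / 2 * X.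
  rewrite /X mulrCA [leRHS]mulrC ler_wpM2r ?powR_ge0//.
  rewrite -ler_pdivrMl ?divr_gt0//; near: n; exact: near_ln_ge.
have kX : k2c * n%:R `^ kappa * (`|ln c3| + b * ln n%:R) =
   k2c * `|ln c3| * n%:R `^ kappa + (sq * b + 2 * e2 * (sq * b)) * X by rewrite /X /k2c; ring.
have X0 : 0 <= X by rewrite mulr_ge0 ?powR_ge0// ltW.
have := ler_wpM2r X0 e2b.
rewrite kX in kL.
clear half bk bk2 base bin.
lra.
Unshelve. all: by end_near. Qed.

(** * From the exponential bounds to the limit *)

Theorem theorem1p7 (R : realType) (d : measure_display)
  (T : measurableType d) (P : probability T R)
  (W : nat -> {RV P >-> R}) (mu : R) (G : forall n : nat, T -> rel 'I_n)
  (alpha C : R)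
  (W_iid : iid W)
  (F_continuous : continuous (cdf (W 0%N)))
  (mu_def : ('E_P[W 0%N] = mu%:E)%E)
  (G_model : weighted_random_graph mu W G)
  (alpha_gt1 : 1 < alpha) (alpha_lt2 : alpha < 2) (C_gt0 : 0 < C)
  (W_ge1 : P [set t | 1 <= W 0%N t] = 1%E)
  (W_tail : fine (ccdf (W 0%N) x) / (C * x `^ (- alpha))
              @[x --> +oo] --> (1 : R)) :
  forall gamma a : R,
    Num.max 1 (3 - 3 / 2 * alpha) < gamma -> gamma < 3 -> 0 < a ->
    (lne (P [set t | (a * n%:R `^ gamma < (triangles (G n t))%:R)%R])
       * ((n%:R `^ ((gamma - 1) / 2) * ln n%:R)^-1)%R%:E)%E @[n --> \oo]
      --> (Num.sqrt (2 * a) * ((3 - gamma) / 2 - alpha))%:E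
    /\ Num.sqrt (2 * a) * ((3 - gamma) / 2 - alpha) < 0.
Proof.
move=> gamma a; rewrite gt_max => /andP[gamma1 gamma2] gamma3 a0.
set sq := Num.sqrt (2 * a).
have sq0 : 0 < sq by rewrite sqrtr_gt0 mulr_gt0.
pose kappa := (gamma - 1) / 2.
pose b := alpha - (1 - kappa).
have ka0 : 0 < kappa by rewrite /kappa; lra.
have ka1 : kappa < 1 by rewrite /kappa; lra.
have gE : gamma = 1 + 2 * kappa by rewrite /kappa; field.
have b0 : 0 < b by rewrite /b; lra.
have -> : sq * ((3 - gamma) / 2 - alpha) = - (sq * b) by rewrite /b /kappa; field.
split; last by rewrite oppr_lt0 mulr_gt0.
have mu1 : 1 <= mu by rewrite -lee_fin -mu_def; exact: expectation_ge1.
have al0 : 0 < alpha by lra.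
have [C' C'0 up] := weight_tail_upper al0 C_gt0 W_tail.
have low := weight_tail_lower C_gt0 W_tail.
have C20 : 0 < C / 2 by rewrite divr_gt0.
pose p n := fine (P [set t | a * n%:R `^ gamma < (triangles (G n t))%:R]).
have pE n : P [set t | a * n%:R `^ gamma < (triangles (G n t))%:R] = (p n)%:E.
  rewrite /p fineK//; apply: fin_num_measure.
  exact: (@measurable_triangles _ _ _ P mu W G n (fun k => a * n%:R `^ gamma < k%:R) G_model).
have lower eps : 0 < eps -> \forall n \near \oo,
    expR (- ((sq * b + eps) * (n%:R `^ kappa * ln n%:R))) <= p n.
  move=> eps0.
  have := near_triangles_lower G_model W_iid W_ge1 mu1 alpha_gt1 C20 up low ka0 ka1 gE
    a0 eps0 erefl.
  by apply: filterS => n; rewrite pE lee_fin.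
have upper eps : 0 < eps -> \forall n \near \oo,
    p n <= expR (- ((sq * b - eps) * (n%:R `^ kappa * ln n%:R))).
  move=> eps0.
  have := near_triangles_upper G_model W_iid W_ge1 mu1 alpha_gt1 alpha_lt2 C'0 up ka0 ka1 gE
    gamma2 a0 eps0 erefl.
  by apply: filterS => n; rewrite pE lee_fin.
(* The lower bound makes the probability positive for large [n], so the extended logarithm agrees
   with the real one. *)
have valE : \forall n \near \oo,
    (ln (p n) / (n%:R `^ kappa * ln n%:R))%:E =
    (lne (P [set t | (a * n%:R `^ gamma < (triangles (G n t))%:R)%R])
       * ((n%:R `^ kappa * ln n%:R)^-1)%R%:E)%E.
  have := lower 1 ltr01; apply: filterS => n pn.
  by rewrite pE lne_EFin// (lt_le_trans (expR_gt0 _) pn).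
apply: (cvg_trans (near_eq_cvg valE)).
apply: cvg_EFin; first by near=> n.
apply/cvgrPdist_le => eps eps0.
near=> n.
have n2 : 2 <= n%:R :> R by near: n; exact: nbhs_infty_ger.
have X0 : 0 < n%:R `^ kappa * ln n%:R.
  rewrite mulr_gt0 ?powR_gt0 ?ln_gt0//; lra.
have lo : expR (- ((sq * b + eps) * (n%:R `^ kappa * ln n%:R))) <= p n.
  by near: n; exact: lower.
have hi : p n <= expR (- ((sq * b - eps) * (n%:R `^ kappa * ln n%:R))).
  by near: n; exact: upper.
have p0 : 0 < p n by exact: lt_le_trans (expR_gt0 _) lo.
rewrite -(lnK (p0 : p n \is Num.pos)) ler_expR in lo.
rewrite -[X in X <= _](lnK (p0 : p n \is Num.pos)) ler_expR in hi.
rewrite /= distrC ler_distl; apply/andP; split.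
  by rewrite ler_pdivlMr//; lra.
by rewrite ler_pdivrMr//; lra.
Unshelve. all: by end_near. Qed.
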